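(* Let $0<\alpha<\frac12$, $\lambda=\frac{\alpha}{1-\alpha}\in(0,1)$, and $$r_0=\mathbf 1_1,\quad r_1=\begin{pmatrix}\frac1{\sqrt\lambda}&0\\0&-\sqrt\lambda\end{pmatrix},\quad r_2=\begin{pmatrix}0&1\\1&0\end{pmatrix},\quad r_3=\begin{pmatrix}0&-\sqrt\lambda\\\frac1{\sqrt\lambda}&0\end{pmatrix}$$ (resp. the same matrices with $r_3$ replaced by $r_3^*$). Then the left (resp. right) Haar system $\mathbf h_\alpha=\mathbf h_\alpha(r_0,r_1,r_2,r_3)=\{h_j\}_{j\ge0}\subseteq\mathcal R_\alpha$ is a Schauder basis of the predual of the hyperfinite factor $\mathcal R_\alpha$ of type $\mathrm{III}_\lambda$, where $\mathcal R_\alpha$ is embedded in its predual by $x\mapsto\rho_\alpha(\cdot\,x)$ (resp. $x\mapsto\rho_\alpha(x\,\cdot)$).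
   Context: For $\nu\ge1$ let $\mathcal N_\nu$ be the algebra of complex $2^\nu\times2^\nu$ matrices with unit $\mathbf 1_\nu$, with $\mathcal N_\nu\otimes\mathcal N_\mu=\mathcal N_{\nu+\mu}$ via the Kronecker product; $\rho_\nu(x)=\mathrm{Tr}(xA_\nu)$, where $A_\nu=\bigotimes_{k=1}^\nu\begin{pmatrix}\alpha&0\\0&1-\alpha\end{pmatrix}$; and $i_\nu:\mathcal N_\nu\to\mathcal N_{\nu+1}$, $i_\nu(x)=x\otimes\mathbf 1_1$. $\mathcal R_\alpha$ is the von Neumann algebra generated by the GNS representation of the $C^*$-inductive limit of $(\mathcal N_\nu,i_\nu)$ with respect to the state $\rho_\alpha$ induced by the states $\rho_\nu$; it carries the faithful normal state $\rho_\alpha$, and $\pi_\nu:\mathcal N_\nu\to\mathcal R_\alpha$ are the canonical embeddings. For $0<\alpha<\frac12$ it is the hyperfinite factor of type $\mathrm{III}_\lambda$, $\lambda=\frac\alpha{1-\alpha}$. Matrix units in shell enumeration: $\{e^{(\nu)}_m\}_{0\le m<4^\nu}$, where the matrix unit with entry $1$ in row $a$, column $b$ ($1\le a,b\le2^\nu$) gets index $m=s(a,b)-1$, with $s(a,b)=(b-1)^2+a$ if $a\le b$ and $s(a,b)=a^2-b+1$ if $a>b$. Haar system (constructed from $r_0=\mathbf 1_1,r_1,r_2,r_3\in\mathcal N_1$): $\mathbf h_1=\{r_0,r_1,r_2,r_3\}$ and, inductively, for $j=4^\nu q+k$ with $0\le q\le3$, $0\le k<4^\nu$, $h^{(\nu+1)}_j=i_\nu(h^{(\nu)}_k)(\mathbf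 1_\nu\otimes r_0)$ if $q=0$ and $h^{(\nu+1)}_j=i_\nu(e^{(\nu)}_k)(\mathbf 1_\nu\otimes r_q)$ if $q\ne0$. The system is called left if $\rho_1(r_j^*r_k)=\delta_{jk}$ and right if $\rho_1(r_jr_k^* )=\delta_{jk}$. Since $r_0=\mathbf 1_1$, $h^{(\nu+1)}_j=i_\nu(h^{(\nu)}_j)$ for $j<4^\nu$, and $h_j:=\pi_\nu(h^{(\nu)}_j)$ for any $\nu$ with $j<4^\nu$. *)

(* Defs.v *)
From HB Require Import structures.
From mathcomp Require Import all_boot all_order all_algebra.
From mathcomp Require Import complex mxtens.
From mathcomp Require Import all_classical all_reals all_analysis.
Import Order.TTheory GRing.Theory Num.Theory.
Import numFieldNormedType.Exports.

Set Implicit Arguments.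
Unset Strict Implicit.
Unset Printing Implicit Defensive.

Local Open Scope classical_set_scope.
Local Open Scope ring_scope.
Local Open Scope complex_scope.
Local Open Scope sesquilinear_scope.

(* Inner products are linear in the first argument. *)
HB.mixin Record NormedModule_isHilbert (R : realType) V
    & NormedModule R[i] V := {
  dot : {dot V for (@Num.conj R[i])} ;
  dot_norm : forall u : V, dot u u = `|u| ^+ 2
}.

#[short(type="hilbertType")]
HB.structure Definition Hilbert (R : realType) :=
  {V of CompleteNormedModule R[i] V & NormedModule_isHilbert R V}.

(* Unital C*-algebras.  The multiplication is a field of the mixin because
   [GRing.Algebra] and [CompleteNormedModule] have no common join. *)
HB.mixin Record CompleteNormedModule_isCStar (R : realType) A
    & CompleteNormedModule R[i] A := {
  cmul : A -> A -> A ;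
  cone : A ;
  star : A -> A ;
  cmulA : associative cmul ;
  cmul1l : left_id cone cmul ;
  cmul1r : right_id cone cmul ;
  cmul_linearl : forall b : A, linear (cmul ^~ b) ;
  cmul_linearr : forall a : A, linear (cmul a) ;
  star_semilinear : forall (c : R[i]) (a b : A),
    star (c *: a + b) = Num.conj c *: star a + star b ;
  starM : forall a b : A, star (cmul a b) = cmul (star b) (star a) ;
  starK : involutive star ;
  cmul_norm : forall a b : A, `|cmul a b| <= `|a| * `|b| ;
  star_norm : forall a : A, `|cmul (star a) a| = `|a| ^+ 2
}.

#[short(type="cstarType")]
HB.structure Definition CStar (R : realType) :=
  {A of CompleteNormedModule R[i] A & CompleteNormedModule_isCStar R A}.

Section bounded_operators.
Context {R : realType} {H : hilbertType R}.

Definition bounded_operator (T : H -> H) : Prop :=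
  linear T /\ exists c : R[i], forall u, `|T u| <= c * `|u|.

Definition bounded_operator_pred : {pred H -> H} :=
  fun T => `[< bounded_operator T >].

Record bop := Bop { bop_fun :> H -> H ; _ : bop_fun \in bounded_operator_pred }.

HB.instance Definition _ := [isSub of bop for bop_fun].
HB.instance Definition _ := [Choice of bop by <:].

Lemma bopP (T : bop) : bounded_operator T.
Proof. exact/asboolP/(valP T). Qed.

Lemma bounded_operator_submod_closed : submod_closed bounded_operator_pred.
Proof.
split.
  apply/asboolP; split; first by move=> a u v; rewrite /= scaler0 addr0.
  by exists 0 => u; rewrite mul0r normr0.
move=> a S T /asboolP[linS [c Sc]] /asboolP[linT [d Td]].
apply/asboolP; split.
  move=> b u v.
  rewrite !fctE linS linT !scalerDr !scalerA (mulrC a b) addrACA.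
  by rewrite -!scalerA.
exists (`|a| * c + d) => u; rewrite !fctE.
rewrite (le_trans (ler_normD _ _))// mulrDl lerD//.
by rewrite normrZ -mulrA ler_wpM2l.
Qed.

HB.instance Definition _ := GRing.isSubmodClosed.Build R[i] (H -> H)
  bounded_operator_pred bounded_operator_submod_closed.
HB.instance Definition _ := [SubChoice_isSubLmodule of bop by <:].

Lemma bop_comp_subproof (S T : bop) : S \o T \in bounded_operator_pred.
Proof.
have [linS [c Sc]] := bopP S; have [linT [d Td]] := bopP T.
apply/asboolP; split; first by move=> a u v; rewrite /= linT linS.
exists (`|c| * d) => u; rewrite /= (le_trans (Sc _))//.
have [->|Tu0] := eqVneq (T u) 0.
  rewrite normr0 mulr0 -mulrA mulr_ge0//.
  by rewrite (le_trans _ (Td u)).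
have Tgt0 : 0 < `|T u| by rewrite normr_gt0.
have c0 : 0 <= c by rewrite -(pmulr_lge0 _ Tgt0) (le_trans _ (Sc _)).
by rewrite (ger0_norm c0) -mulrA ler_wpM2l.
Qed.

Definition bop_comp (S T : bop) : bop := Bop (bop_comp_subproof S T).

Lemma bop_id_subproof : (id : H -> H) \in bounded_operator_pred.
Proof.
apply/asboolP; split; first by [].
by exists 1 => u; rewrite mul1r.
Qed.

Definition bop_id : bop := Bop bop_id_subproof.

(* the operator norm of T is at most 1 *)
Definition contractive (T : bop) : Prop := forall u, `|T u| <= `|u|.

Definition commutant (S : set bop) : set bop :=
  [set T | forall U, S U -> bop_comp T U = bop_comp U T].

End bounded_operators.
Arguments bop {R} H.

Section von_neumann_algebra.
Context {R : realType} {H : hilbertType R}.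
Implicit Type S : set (bop H).

Definition bicommutant S : {pred bop H} :=
  fun T => `[< commutant (commutant S) T >].

(* The von Neumann algebra generated by S, as a type.  The bicommutant is the
   von Neumann algebra generated by S when S is closed under adjoints. *)
Record vnalg S := VNalg { vn_op :> bop H ; _ : vn_op \in bicommutant S }.

HB.instance Definition _ S := [isSub of vnalg S for @vn_op S].
HB.instance Definition _ S := [Choice of vnalg S by <:].

Lemma bicommutant_submod_closed S : submod_closed (bicommutant S).
Proof.
split.
  apply/asboolP => U SU; apply/val_inj/funext => u /=.
  by have [linU _] := bopP U; have := linU (-1) 0 0;
    rewrite !scaleN1r oppr0 addr0 addNr.
move=> a T T' /asboolP ST /asboolP ST'; apply/asboolP => U SU.
apply/val_inj/funext => u /=.
have [linU _] := bopP U.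
have TU := congr1 (fun V : bop H => V u) (ST U SU).
have TU' := congr1 (fun V : bop H => V u) (ST' U SU).
rewrite /= in TU TU'.
rewrite -[LHS]/(a *: T (U u) + T' (U u)) -[RHS]/(U (a *: T u + T' u)).
by rewrite TU TU' linU.
Qed.

HB.instance Definition _ S := GRing.isSubmodClosed.Build R[i] (bop H)
  (bicommutant S) (@bicommutant_submod_closed S).
HB.instance Definition _ S := [SubChoice_isSubLmodule of vnalg S by <:].

Lemma vn_mul_subproof S (x y : vnalg S) : bop_comp x y \in bicommutant S.
Proof.
have /asboolP Sx := valP x; have /asboolP Sy := valP y.
apply/asboolP => U SU; apply/val_inj/funext => u /=.
have xU := congr1 (fun V : bop H => V (y u)) (Sx U SU).
have yU := congr1 (fun V : bop H => V u) (Sy U SU).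
by rewrite /= in xU yU; rewrite yU xU.
Qed.

Definition vn_mul S (x y : vnalg S) : vnalg S := VNalg (vn_mul_subproof x y).

Lemma vn_gen_subproof S T : S T -> T \in bicommutant S.
Proof. by move=> ST; apply/asboolP => U /(_ _ ST). Qed.

Definition vn_gen S T (ST : S T) : vnalg S := VNalg (vn_gen_subproof ST).

Definition vector_state S (Omega : H) (x : vnalg S) : R[i] :=
  dot (x Omega) Omega.

End von_neumann_algebra.

Section predual.
Context {R : realType} {H : hilbertType R} (S : set (bop H)).

Definition square_summable (xi : nat -> H) : Prop :=
  cvgn (series (fun n => `|xi n| ^+ 2 : R[i]^o)).

(* the functionals whose absolute values define the ultraweak topology *)
Definition ultraweak_pairing (p : (nat -> H) * (nat -> H)) (T : bop H) : R[i] :=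
  limn (series (fun n => dot (T (p.1 n)) (p.2 n) : R[i]^o)).

(* phi is continuous for the ultraweak topology: the finite families F below,
   with d > 0, index its basic neighbourhoods of x. *)
Definition ultraweakly_continuous (phi : vnalg S -> R[i]) : Prop :=
  forall (x : vnalg S) (e : R[i]), 0 < e ->
  exists2 F : seq ((nat -> H) * (nat -> H)),
    forall p, p \in F -> square_summable p.1 /\ square_summable p.2 &
    exists2 d : R[i], 0 < d & forall y : vnalg S,
      (forall p, p \in F ->
         `|ultraweak_pairing p (vn_op y - vn_op x)| < d) ->
      `|phi y - phi x| < e.

(* Norm boundedness follows from ultraweak continuity; as a separate clause it
   makes the supremum below finite. *)
Definition normal_functional (phi : vnalg S -> R[i]^o) : Prop :=
  [/\ linear phi,
      exists c : R, forall x : vnalg S,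
        contractive x -> Normc.normc (phi x) <= c &
      ultraweakly_continuous phi].

Definition normal_functional_pred : {pred vnalg S -> R[i]^o} :=
  fun phi => `[< normal_functional phi >].

(* the ultraweakly continuous linear functionals on the von Neumann algebra
   generated by S, with the norm of its Banach dual *)
Record predual := Predual {
  predual_fun :> vnalg S -> R[i]^o ;
  _ : predual_fun \in normal_functional_pred
}.

HB.instance Definition _ := [isSub of predual for predual_fun].
HB.instance Definition _ := [Choice of predual by <:].

Lemma predualP (phi : predual) : normal_functional phi.
Proof. exact/asboolP/(valP phi). Qed.

Let normcE (z : R[i]) : `|z| = (Normc.normc z)%:C. Proof. by case: z. Qed.

Let normc_ge0 (z : R[i]) : 0 <= Normc.normc z.
Proof. by rewrite -lecR -normcE; exact: (@normr_ge0 R[i]). Qed.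

Lemma normal_functional_submod_closed : submod_closed normal_functional_pred.
Proof.
split.
  apply/asboolP; split.
  - by move=> a x y; rewrite /= scaler0 addr0.
  - by exists 0 => x _; rewrite [X in X <= _](@Normc.normc0 R).
  - move=> x e e0; exists [::] => //; exists 1 => // y _.
    by rewrite /= subr0 normr0.
move=> a f g /asboolP[linf [c fc] uwf] /asboolP[ling [d gd] uwg].
apply/asboolP; split.
- move=> b x y; rewrite !fctE linf ling !scalerDr !scalerA (mulrC a b) addrACA.
  by rewrite -!scalerA.
- exists (Normc.normc a * c + d) => x x1; rewrite !fctE.
  apply: le_trans (@le_normcD R _ _) _; rewrite lerD ?gd//.
  by rewrite -[a *: f x]/((a : R[i]) * f x) (@Normc.normcM R) ler_wpM2l ?fc.
- move=> x e e0.
  have a1 : 0 < `|a| + 1 by rewrite ltr_wpDl.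
  have e1 : 0 < (e / 2) / (`|a| + 1) by rewrite !divr_gt0.
  have e2 : 0 < e / 2 by rewrite divr_gt0.
  have [F Fs [df df0 Ff]] := uwf x _ e1.
  have [G Gs [dg dg0 Gg]] := uwg x _ e2.
  exists (F ++ G); first by move=> p; rewrite mem_cat => /orP[/Fs|/Gs].
  have [m m0 [mf mg]] : exists2 m : R[i], 0 < m & m <= df /\ m <= dg.
    by case/orP: (real_leVge (gtr0_real df0) (gtr0_real dg0)) => h;
      [exists df|exists dg].
  exists m => // y ym; rewrite !fctE.
  rewrite [X in `|X|](_ : _ = a * (f y - f x) + (g y - g x)); last first.
    by rewrite mulrBr opprD addrACA.
  rewrite (splitr e) (le_lt_trans (ler_normD _ _))// ler_ltD//.
    rewrite normrM (@le_trans _ _ (`|a| * ((e / 2) / (`|a| + 1))))//.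
      rewrite ler_wpM2l// ltW// Ff// => p pF.
      by rewrite (lt_le_trans (ym p _))// mem_cat pF.
    rewrite mulrCA ler_piMr ?(ltW e2)// ler_pdivrMr// mul1r.
    by rewrite lerDl.
  by rewrite Gg// => p pG; rewrite (lt_le_trans (ym p _))// mem_cat pG orbT.
Qed.

HB.instance Definition _ := GRing.isSubmodClosed.Build R[i]
  (vnalg S -> R[i]^o) normal_functional_pred normal_functional_submod_closed.
HB.instance Definition _ := [SubChoice_isSubLmodule of predual by <:].

Definition predual_norm (phi : predual) : R[i] :=
  (sup [set Normc.normc (phi x) | x in [set x : vnalg S | contractive x]])%:C.

Let values (phi : predual) : set R :=
  [set Normc.normc (phi x) | x in [set x : vnalg S | contractive x]].

Let contractive0 : contractive (0 : vnalg S).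
Proof. by move=> u; rewrite /= normr0. Qed.

Let values_has_sup (phi : predual) : has_sup (values phi).
Proof.
have [_ [c phic] _] := predualP phi; split.
  by exists (Normc.normc (phi 0)); exists 0.
by exists c => _ [x x1 <-]; exact: phic.
Qed.

Let values_sup (phi : predual) (x : vnalg S) :
  contractive x -> Normc.normc (phi x) <= sup (values phi).
Proof.
by move=> x1; apply: sup_upper_bound (values_has_sup phi) _ _; exists x.
Qed.

Let sup_values_le (phi : predual) (c : R) :
  (forall x : vnalg S, contractive x -> Normc.normc (phi x) <= c) ->
  sup (values phi) <= c.
Proof.
move=> phic; apply: ge_sup; first by case: (values_has_sup phi).
by move=> _ [x x1 <-]; exact: phic.
Qed.

Lemma predual_normD (phi psi : predual) :
  predual_norm (phi + psi) <= predual_norm phi + predual_norm psi.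
Proof.
rewrite /predual_norm -rmorphD lecR; apply: sup_values_le => x x1.
by apply: le_trans (@le_normcD R _ _) _; rewrite lerD//; exact: values_sup.
Qed.

Lemma predual_normZ (a : R[i]) (phi : predual) :
  predual_norm (a *: phi) = `|a| * predual_norm phi.
Proof.
have leZ b psi : sup (values (b *: psi)) <= Normc.normc b * sup (values psi).
  apply: sup_values_le => x x1.
  rewrite -[(b *: psi) x]/((b : R[i]) * psi x) (@Normc.normcM R).
  by rewrite ler_wpM2l//; exact: values_sup.
rewrite normcE /predual_norm -rmorphM; congr (_%:C).
apply/eqP; rewrite eq_le leZ /=.
have [->|a0] := eqVneq a 0.
  rewrite (@Normc.normc0 R) mul0r.
  exact: le_trans (normc_ge0 _) (values_sup (0 *: phi) contractive0).
have na0 : 0 < Normc.normc a by rewrite -ltcR -normcE normr_gt0.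
rewrite -ler_pdivlMl// -Normc.normcV.
by rewrite (le_trans _ (leZ a^-1 (a *: phi)))// scalerA mulVf// scale1r.
Qed.

Lemma predual_norm0_eq0 (phi : predual) : predual_norm phi = 0 -> phi = 0.
Proof.
move=> [phi0]; apply/val_inj/funext => x.
have [linx [c xc]] := bopP x; have [linphi _ _] := predualP phi.
have phiZ b y : phi (b *: y) = b * phi y.
  have phi00 : phi 0 = 0.
    by have := linphi (-1) 0 0; rewrite !scaleN1r oppr0 addr0 addNr.
  by have := linphi b y 0; rewrite phi00 !addr0.
have d0 : 0 < `|c| + 1 by rewrite ltr_wpDl.
have cx : contractive ((`|c| + 1)^-1 *: x).
  move=> u; rewrite -[X in `|X|]/((`|c| + 1)^-1 *: x u) normrZ.
  rewrite ger0_norm ?invr_ge0 ?(ltW d0)// ler_pdivrMl//.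
  have [u0|u0] := eqVneq `|u| 0.
    by rewrite (le_trans (xc u))// u0 !mulr0.
  have ugt0 : 0 < `|u| by rewrite lt_def u0 normr_ge0.
  have c0 : 0 <= c by rewrite -(pmulr_lge0 _ ugt0) (le_trans _ (xc u)).
  by rewrite (le_trans (xc u))// ler_wpM2r// (ger0_norm c0) lerDl.
have := values_sup phi cx; rewrite phi0 phiZ => le0.
have /Normc.eq0_normc/eqP : Normc.normc ((`|c| + 1)^-1 * phi x) = 0.
  by apply/eqP; rewrite eq_le le0 normc_ge0.
by rewrite mulf_eq0 invr_eq0 (gt_eqF d0)/= => /eqP.
Qed.

HB.instance Definition _ := Lmodule_isNormed.Build R[i] predual
  predual_normD predual_normZ predual_norm0_eq0.

End predual.

Definition schauder_basis {K : numFieldType} {X : normedModType K}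
    (e : nat -> X) : Prop :=
  forall x : X, exists! a : nat -> K, series (fun n => a n *: e n) @ \oo --> x.

(* Throughout, the index n : nat stands for nu = n + 1 >= 1, so the n-th matrix
   algebra is 'M_(2 ^ n.+1). *)
Section matrix_algebras.
Context {R : realType}.
Local Notation C := R[i].

Definition kron n (x : 'M[C]_(2 ^ n.+1)) (y : 'M[C]_2) : 'M[C]_(2 ^ n.+2) :=
  castmx (esym (expnSr 2 n.+1), esym (expnSr 2 n.+1)) (x *t y).

Definition incl n (x : 'M[C]_(2 ^ n.+1)) : 'M[C]_(2 ^ n.+2) := kron x 1%:M.

Definition mx2 (a b c d : C) : 'M[C]_2 :=
  \matrix_(i, j) if i == 0 then (if j == 0 then a else b)
                 else (if j == 0 then c else d).

Fixpoint density (alpha : R) n : 'M[C]_(2 ^ n.+1) :=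
  let A1 := mx2 alpha%:C 0 0 (1 - alpha)%:C in
  if n is m.+1 then kron (density alpha m) A1 else A1.

Definition level_state (alpha : R) n (x : 'M[C]_(2 ^ n.+1)) : C :=
  \tr (x *m density alpha n).

(* Rows and columns are numbered from 1. *)
Definition shell (a b : nat) : nat :=
  (if a <= b then b.-1 ^ 2 + a else a ^ 2 - b + 1)%N.

Definition matrix_unit n (m : nat) : 'M[C]_(2 ^ n.+1) :=
  \matrix_(i, j) ((shell i.+1 j.+1).-1 == m)%:R.

(* Meant for j < 4 ^ n.+1; the values at larger j are irrelevant. *)
Fixpoint haar (r : 'I_4 -> 'M[C]_2) n (j : nat) : 'M[C]_(2 ^ n.+1) :=
  if n is m.+1 then
    let q := (j %/ 4 ^ m.+1)%N in
    let k := (j %% 4 ^ m.+1)%N in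
    if q == 0%N then incl (haar r m k) *m kron 1%:M (r 0)
    else incl (matrix_unit m k) *m kron 1%:M (r (inord q))
  else r (inord j).

Definition left_system (alpha : R) (r : 'I_4 -> 'M[C]_2) : Prop :=
  forall j k, @level_state alpha 0 ((r j) ^t* *m r k) = (j == k)%:R.

Definition right_system (alpha : R) (r : 'I_4 -> 'M[C]_2) : Prop :=
  forall j k, @level_state alpha 0 (r j *m (r k) ^t*) = (j == k)%:R.

Definition r_left (lambda : R) : 'I_4 -> 'M[C]_2 :=
  let s := (Num.sqrt lambda)%:C in
  tnth [tuple 1%:M; mx2 s^-1 0 0 (- s); mx2 0 1 1 0; mx2 0 (- s) s^-1 0].

Definition r_right (lambda : R) : 'I_4 -> 'M[C]_2 :=
  let s := (Num.sqrt lambda)%:C in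
  tnth [tuple 1%:M; mx2 s^-1 0 0 (- s); mx2 0 1 1 0; (mx2 0 (- s) s^-1 0) ^t*].

End matrix_algebras.

Section inductive_limit.
Context {R : realType} {A : cstarType R}.
Local Notation C := R[i].

Definition star_morphism d (f : 'M[C]_d -> A) : Prop :=
  [/\ linear f, forall x y, f (x *m y) = cmul (f x) (f y),
      f 1%:M = cone & forall x, f (x ^t*) = star (f x)].

(* A, with the maps f n, is the C*-inductive limit of the matrix algebras along
   the maps incl, i.e. the completion of their union. *)
Definition inductive_limit (f : forall n, 'M[C]_(2 ^ n.+1) -> A) : Prop :=
  [/\ forall n, star_morphism (f n), forall n, injective (f n),
      forall n x, f n.+1 (incl x) = f n x &
      closure (\bigcup_n range (f n)) = setT].

Definition state (rho : A -> C) : Prop :=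
  [/\ scalar rho, forall a, 0 <= rho (cmul (star a) a) & rho cone = 1].

Context {H : hilbertType R}.

Definition star_representation (pi : A -> bop H) : Prop :=
  [/\ linear pi, forall a b, pi (cmul a b) = bop_comp (pi a) (pi b),
      pi cone = bop_id & forall a u v, dot (pi a u) v = dot u (pi (star a) v)].

(* Up to unitary equivalence this is the GNS triple of rho. *)
Definition gns (rho : A -> C) (pi : A -> bop H) (Omega : H) : Prop :=
  [/\ star_representation pi, closure (range (fun a => pi a Omega)) = setT &
      forall a, dot (pi a Omega) Omega = rho a].

Definition to_vnalg (pi : A -> bop H) (a : A) : vnalg (range pi) :=
  vn_gen (imageT pi a).

(* The element h_j of level nu is independent of nu as soon as j < 4 ^ nu (see
   [haar_seqE]); nu = j + 1 is one such level. *)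
Definition haar_seq (pi : A -> bop H) (f : forall n, 'M[C]_(2 ^ n.+1) -> A)
    (r : 'I_4 -> 'M[C]_2) (j : nat) : vnalg (range pi) :=
  to_vnalg pi (f j (haar r j j)).

Lemma kron1 n : kron 1%:M 1%:M = 1%:M :> 'M[C]_(2 ^ n.+2).
Proof.
apply/matrixP => i j; rewrite castmxE !mxE -natrM mulnb; congr (_%:R).
congr (nat_of_bool _); apply/andP/eqP => [[/eqP e1 /eqP e2]|->//].
apply: (@cast_ord_inj _ _ (esym (esym (expnSr 2 n.+1)))).
apply: (can_inj (@mxtens_unindexK (2 ^ n.+1) 2)).
by rewrite (surjective_pairing (mxtens_unindex _)) e1 e2 -surjective_pairing.
Qed.

Lemma haar_seqE (pi : A -> bop H) (f : forall n, 'M[C]_(2 ^ n.+1) -> A)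
    (r : 'I_4 -> 'M[C]_2) (n j : nat) :
  inductive_limit f -> r 0 = 1%:M -> (j < 4 ^ n.+1)%N ->
  haar_seq pi f r j = to_vnalg pi (f n (haar r n j)).
Proof.
move=> [_ _ fincl _] r0 jn.
have step m : (j < 4 ^ m.+1)%N -> f m.+1 (haar r m.+1 j) = f m (haar r m j).
  by move=> jm; rewrite /= divn_small// modn_small// r0 kron1 mulmx1 fincl.
have up m k : (j < 4 ^ m.+1)%N ->
    f (m + k)%N (haar r (m + k) j) = f m (haar r m j).
  move=> jm; elim: k => [|k IH]; first by rewrite addn0.
  rewrite addnS step// (leq_trans jm)// leq_exp2l// ltnS leq_addr//.
have jj : (j < 4 ^ j.+1)%N by rewrite (ltn_trans (ltnSn j))// ltn_expl.
rewrite /haar_seq; congr to_vnalg.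
by rewrite -(up j n jj) -(up n j jn) addnC.
Qed.

End inductive_limit.

(* Main.v *)
Require Import Defs.
From HB Require Import structures.
From mathcomp Require Import all_boot all_order all_algebra.
From mathcomp Require Import complex mxtens.
From mathcomp Require Import all_classical all_reals all_analysis.
From mathcomp Require Import ring zify.
Import Order.TTheory GRing.Theory Num.Theory.
Import numFieldNormedType.Exports.
Set Implicit Arguments.
Unset Strict Implicit.
Unset Printing Implicit Defensive.
Local Open Scope classical_set_scope.
Local Open Scope ring_scope.

(** Let [phi] be the vector state on the von Neumann algebra, [h_j] the Haar
    elements, and consider the left system, so that [x] is identified with the
    functional [y |-> phi (y x)].  By orthogonality of the [h_j], the expansion of
    a normal functional [psi] can only have the coefficients
    [psi (h_j^* ) / phi (h_j^* h_j)].  That these expansions converge follows from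
    two facts: the span of the [h_j] is norm dense in the predual, and the partial
    sums of the expansions are uniformly bounded ([schauder_criterion]).

    Orthogonality.  An element of level [n + 1] is [u (x) r_q], where [u] is a Haar
    matrix of level [n] if [q = 0] and a matrix unit otherwise, and the state is a
    product.  Counting dimensions, the Haar matrices of a level form a basis of
    that matrix algebra ([haar_orthogonal], [haar_complete]).

    Density.  The density matrices [D] are diagonal and invertible.  Therefore
    right multiplication by a matrix [b] is bounded for the GNS norm, with a bound
    that does not grow when further tensor factors are added; it extends to an
    operator of the commutant, whose adjoint is right multiplication by
    [D b^* D^-1] ([right_mul_adj]).  Consequently [<y a Omega, b Omega>], for [y]
    in the von Neumann algebra, equals both [phi (y c)] and [phi (c' y)] for
    suitable matrices [c] and [c'] ([kms_transfer]).  The vectors [a Omega] are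
    dense because states of a C*-algebra are bounded, and an ultraweakly continuous
    functional is a norm limit of finite sums of vector functionals; so the
    matrices are dense in the predual ([approximable_normal]).  The same identity
    shows that [Omega] is separating, which gives the injectivity of the embedding,
    and yields the contractive conditional expectations [E_n] onto the matrix
    algebras ([cond_exp]).

    Boundedness.  The [m]-th partial sum of the expansion of [psi] is the functional
    [psi o G_m] with [G_m y] the sum of the [phi (y h_j) h_j^* / phi (h_j^* h_j)]
    for [j < m].  If [m = 4 ^ n q + K] with [0 < q < 4] and [K <= 4 ^ n], then [G_m y]
    is the sum of [E_n y], of [E_n (y r_p) r_p^*] for [0 < p < q], and of
    [T_K (E_n (y r_q)) r_q^*], where [T_K] keeps the entries of a matrix whose
    transposed position is among the first [K] in the shell order.  These positions
    fill a square, a piece of a column and a piece of a row, so [T_K] is a sum of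
    three compressions [z |-> P z Q] by diagonal projections ([shell0_initial]), and
    [G_m] is bounded independently of [m] ([haar_partial_sum_bounded]).

    The right system is treated simultaneously: a boolean [s] decides on which side
    the products are taken. *)

(** * Tensor products of matrices and the product state *)

(** The statements below produce linear maps as bare functions together with a
    linearity proof; these lemmas give them the usual theory. *)
Section raw_linear.
Variables (K : nzRingType) (U : lmodType K) (V : zmodType).
Variables (s : GRing.Scale.law K V) (f : U -> V) (lf : linear_for s f).

Let g : {linear U -> V | s} := HB.pack f (GRing.isLinear.Build _ _ _ _ f lf).

Lemma lin0 : f 0 = 0. Proof. exact: (linear0 g). Qed.
Lemma linD x y : f (x + y) = f x + f y. Proof. exact: (linearD g). Qed.
Lemma linB x y : f (x - y) = f x - f y. Proof. exact: (linearB g). Qed.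
Lemma linZ c x : f (c *: x) = s c (f x).
Proof. exact: (linearZ_LR (g : {linear U -> V | s})). Qed.
Lemma lin_sum I (r : seq I) (P : pred I) (E : I -> U) :
  f (\sum_(i <- r | P i) E i) = \sum_(i <- r | P i) f (E i).
Proof. exact: (linear_sum g). Qed.

End raw_linear.

Section kronecker.
Local Open Scope sesquilinear_scope.
Context {R : realType}.
Local Notation C := R[i].
Local Notation incl := Defs.incl.

(** The index of a Kronecker product as a pair of indices: all entrywise
    computations go through this bijection, never through the casts. *)
Definition kron_index n (i : 'I_(2 ^ n.+1)) (p : 'I_2) : 'I_(2 ^ n.+2) :=
  cast_ord (esym (expnSr 2 n.+1)) (mxtens_index (i, p)).

Lemma kron_index_bij n : bijective (fun u : 'I_(2 ^ n.+1) * 'I_2 => kron_index u.1 u.2).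
Proof.
exists (fun k => mxtens_unindex (cast_ord (expnSr 2 n.+1) k)) => [[i p]|k].
  by rewrite /kron_index cast_ord_comp cast_ord_id mxtens_indexK.
have := mxtens_unindexK (cast_ord (expnSr 2 n.+1) k).
by rewrite /kron_index => ->; rewrite cast_ord_comp cast_ord_id.
Qed.

Lemma kron_indexP n (k : 'I_(2 ^ n.+2)) : exists i p, k = kron_index i p.
Proof. by have [g _ gK] := kron_index_bij n; exists (g k).1, (g k).2; rewrite gK. Qed.

Lemma kron_index_eq n (i j : 'I_(2 ^ n.+1)) p q :
  (kron_index i p == kron_index j q) = (i == j) && (p == q).
Proof.
by rewrite -[RHS]/((i, p) == (j, q)); have := bij_eq (kron_index_bij n) (i, p) (j, q).
Qed.

Lemma big_kron_index n (F : 'I_(2 ^ n.+2) -> C) :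
  \sum_k F k = \sum_i \sum_p F (kron_index i p).
Proof.
rewrite pair_big/= (reindex (fun u : 'I_(2 ^ n.+1) * 'I_2 => kron_index u.1 u.2))//.
exact/onW_bij/kron_index_bij.
Qed.

Lemma kron_index_mxP n (x y : 'M[C]_(2 ^ n.+2)) :
  (forall i p j q,
    x (kron_index i p) (kron_index j q) = y (kron_index i p) (kron_index j q)) ->
  x = y.
Proof.
move=> xy; apply/matrixP => k l.
by have [i [p ->]] := kron_indexP k; have [j [q ->]] := kron_indexP l.
Qed.

Lemma kronE n (x : 'M[C]_(2 ^ n.+1)) (y : 'M[C]_2) i p j q :
  kron x y (kron_index i p) (kron_index j q) = x i j * y p q.
Proof. by rewrite castmxE !cast_ord_comp !cast_ord_id tensmxE. Qed.

Lemma kron_mul n (x x' : 'M[C]_(2 ^ n.+1)) (y y' : 'M[C]_2) :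
  kron x y *m kron x' y' = kron (x *m x') (y *m y').
Proof.
apply: kron_index_mxP => i p j q; rewrite kronE !mxE big_kron_index mulr_suml.
apply: eq_bigr => k _; rewrite mulr_sumr; apply: eq_bigr => l _.
by rewrite !kronE mulrACA.
Qed.

Lemma kron_adj n (x : 'M[C]_(2 ^ n.+1)) (y : 'M[C]_2) :
  (kron x y) ^t* = kron (x ^t*) (y ^t*).
Proof.
by apply: kron_index_mxP => i p j q; rewrite !mxE !kronE !mxE rmorphM.
Qed.

Lemma kron_linearl n (y : 'M[C]_2) : linear (fun x : 'M[C]_(2 ^ n.+1) => kron x y).
Proof.
by move=> c u v; apply: kron_index_mxP => i p j q; rewrite !mxE !kronE !mxE mulrDl mulrA.
Qed.

Lemma kron_linearr n (x : 'M[C]_(2 ^ n.+1)) : linear (kron x).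
Proof.
move=> c u v; apply: kron_index_mxP => i p j q.
by rewrite !mxE !kronE !mxE mulrDr mulrCA.
Qed.

Lemma mxtrace_kron n (x : 'M[C]_(2 ^ n.+1)) (y : 'M[C]_2) :
  \tr (kron x y) = \tr x * \tr y.
Proof.
rewrite /mxtrace big_kron_index mulr_suml; apply: eq_bigr => i _.
by rewrite mulr_sumr; apply: eq_bigr => p _; rewrite kronE.
Qed.

Lemma adjmxM d (x y : 'M[C]_d) : (x *m y) ^t* = y ^t* *m x ^t*.
Proof. by rewrite trmx_mul map_mxM. Qed.

Lemma adjmxK d (x : 'M[C]_d) : (x ^t*) ^t* = x.
Proof. by apply/matrixP => i j; rewrite !mxE conjCK. Qed.

Lemma incl_adj n (x : 'M[C]_(2 ^ n.+1)) : (incl x) ^t* = incl (x ^t*).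
Proof.
rewrite /incl kron_adj; congr kron; apply/matrixP => i j.
by rewrite !mxE eq_sym rmorph_nat.
Qed.

End kronecker.

Section product_state.
Local Open Scope sesquilinear_scope.
Context {R : realType}.
Local Notation C := R[i].
Local Notation incl := Defs.incl.
Variable alpha : R.
Hypotheses (alpha_gt0 : 0 < alpha) (alpha_lt1 : alpha < 1).

Definition weight n (i : 'I_(2 ^ n.+1)) : C := density alpha n i i.

Lemma densityE n i j : density alpha n i j = weight i *+ (i == j).
Proof.
rewrite /weight; elim: n i j => [|n IH] i j.
  by rewrite /= !mxE; move: i j => [[|[]]//= ?] [[|[]]//= ?].
have [i' [p ->]] := kron_indexP i; have [j' [q ->]] := kron_indexP j.
rewrite /= !kronE IH kron_index_eq !mxE.
case: eqVneq => [->|_] /=; last by rewrite mul0r.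
by move: p q => [[|[]]//= ?] [[|[]]//= ?]; rewrite ?mulr0.
Qed.

Lemma weight_kron_index n i p : @weight n.+1 (kron_index i p) = weight i * @weight 0 p.
Proof. by rewrite /weight /= kronE. Qed.

Lemma weight_gt0 n i : 0 < @weight n i.
Proof.
elim: n i => [|n IH] i; last first.
  have [i' [p ->]] := kron_indexP i.
  rewrite weight_kron_index mulr_gt0 ?IH//.
  by rewrite /weight /= mxE; case: eqP => _; rewrite ltcR ?subr_gt0.
by rewrite /weight /= mxE; case: eqP => _; rewrite ltcR ?subr_gt0.
Qed.

Lemma weight_ge0 n i : 0 <= @weight n i.
Proof. exact: ltW (weight_gt0 i). Qed.

Lemma weight_neq0 n i : @weight n i != 0.
Proof. by rewrite gt_eqF ?weight_gt0. Qed.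

Lemma weight_conj n i : (@weight n i)^* = weight i.
Proof. by apply/conj_Creal/ger0_real/ltW/weight_gt0. Qed.

Local Notation tau := (level_state alpha).

Lemma level_stateE n (x : 'M[C]_(2 ^ n.+1)) : tau x = \sum_i x i i * weight i.
Proof.
apply: eq_bigr => i _; rewrite mxE (bigD1 i)//= densityE eqxx big1 ?addr0//.
by move=> j ji; rewrite densityE (negPf ji) mulr0.
Qed.

Lemma level_state_scalar n : scalar (@level_state R alpha n).
Proof.
move=> c x y; rewrite !level_stateE mulr_sumr -big_split/=.
by apply: eq_bigr => i _; rewrite !mxE mulrDl mulrA.
Qed.

HB.instance Definition _ n := GRing.isLinear.Build C 'M[C]_(2 ^ n.+1) C _
  (@level_state R alpha n) (@level_state_scalar n).

Lemma level_state_kron n (x : 'M[C]_(2 ^ n.+1)) (y : 'M[C]_2) :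
  tau (kron x y) = tau x * @level_state R alpha 0 y.
Proof. by rewrite /level_state /= kron_mul mxtrace_kron. Qed.

Lemma level_state_conj n (x : 'M[C]_(2 ^ n.+1)) : tau (x ^t*) = (tau x)^*.
Proof.
rewrite !level_stateE rmorph_sum; apply: eq_bigr => i _.
by rewrite rmorphM /= weight_conj !mxE.
Qed.

Lemma level_state_sq n (x : 'M[C]_(2 ^ n.+1)) :
  tau (x ^t* *m x) = \sum_l \sum_k `|x k l| ^+ 2 * weight l.
Proof.
rewrite level_stateE; apply: eq_bigr => l _; rewrite mxE mulr_suml.
by apply: eq_bigr => k _; rewrite !mxE normCK (mulrC (x k l)).
Qed.

(** The [2 x 2] blocks with respect to the last tensor factor, in which [incl b]
    is block diagonal with both diagonal blocks equal to [b]. *)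
Definition kron_block n (x : 'M[C]_(2 ^ n.+2)) (p q : 'I_2) : 'M[C]_(2 ^ n.+1) :=
  \matrix_(i, j) x (kron_index i p) (kron_index j q).

Lemma kron_block_mul_inclr n (x : 'M[C]_(2 ^ n.+2)) (b : 'M[C]_(2 ^ n.+1)) p q :
  kron_block (x *m incl b) p q = kron_block x p q *m b.
Proof.
apply/matrixP => i j; rewrite !mxE big_kron_index; apply: eq_bigr => k _.
rewrite (bigD1 q)//= big1 ?addr0 => [|l lq].
  by rewrite kronE !mxE eqxx mulr1.
by rewrite kronE !mxE (negPf lq) !mulr0.
Qed.

Lemma kron_block_mul_incll n (c : 'M[C]_(2 ^ n.+1)) (x : 'M[C]_(2 ^ n.+2)) p q :
  kron_block (incl c *m x) p q = c *m kron_block x p q.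
Proof.
apply/matrixP => i j; rewrite !mxE big_kron_index; apply: eq_bigr => k _.
rewrite (bigD1 p)//= big1 ?addr0 => [|l lp].
  by rewrite kronE !mxE eqxx mulr1.
by rewrite kronE !mxE eq_sym (negPf lp) mulr0 mul0r.
Qed.

(** The GNS norm is a weighted [l^2] sum of the GNS norms of the blocks, so bounds
    for one-sided multiplications survive an additional tensor factor. *)
Lemma level_state_block n (x : 'M[C]_(2 ^ n.+2)) :
  tau (x ^t* *m x) =
  \sum_p \sum_q @weight 0 q * tau ((kron_block x p q) ^t* *m kron_block x p q).
Proof.
rewrite level_state_sq big_kron_index exchange_big/=.
under eq_bigr do under eq_bigr do rewrite big_kron_index exchange_big/=.
under eq_bigr do rewrite exchange_big/=.
rewrite exchange_big/=; apply: eq_bigr => p _; apply: eq_bigr => q _.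
rewrite level_state_sq mulr_sumr; apply: eq_bigr => l _; rewrite mulr_sumr.
by apply: eq_bigr => k _; rewrite weight_kron_index !mxE mulrA mulrC.
Qed.

Definition rmul_bounded n (b : 'M[C]_(2 ^ n.+1)) (K : C) : Prop :=
  forall a : 'M[C]_(2 ^ n.+1),
    tau ((a *m b) ^t* *m (a *m b)) <= K * tau (a ^t* *m a).
Definition lmul_bounded n (b : 'M[C]_(2 ^ n.+1)) (K : C) : Prop :=
  forall a : 'M[C]_(2 ^ n.+1),
    tau ((b *m a) ^t* *m (b *m a)) <= K * tau (a ^t* *m a).

Lemma rmul_bounded_incl n (b : 'M[C]_(2 ^ n.+1)) K :
  rmul_bounded b K -> rmul_bounded (incl b) K.
Proof.
move=> bK a; rewrite !level_state_block// mulr_sumr ler_sum// => p _.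
rewrite mulr_sumr ler_sum// => q _; rewrite kron_block_mul_inclr mulrCA.
by apply: ler_wpM2l (bK _); exact: ltW (weight_gt0 _).
Qed.

Lemma lmul_bounded_incl n (b : 'M[C]_(2 ^ n.+1)) K :
  lmul_bounded b K -> lmul_bounded (incl b) K.
Proof.
move=> bK a; rewrite !level_state_block// mulr_sumr ler_sum// => p _.
rewrite mulr_sumr ler_sum// => q _; rewrite kron_block_mul_incll mulrCA.
by apply: ler_wpM2l (bK _); exact: ltW (weight_gt0 _).
Qed.

(** This is [D b^* D^-1], with [D] the density matrix: the adjoint of right
    multiplication by [b] in the GNS inner product is right multiplication by it. *)
Definition kms_adj n (b : 'M[C]_(2 ^ n.+1)) : 'M[C]_(2 ^ n.+1) :=
  \matrix_(i, j) ((b j i)^* * weight i / weight j).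

Lemma kms_adjP n (x b : 'M[C]_(2 ^ n.+1)) :
  tau (x *m kms_adj b) = tau (b ^t* *m x).
Proof.
rewrite !level_stateE; under eq_bigr do rewrite mxE mulr_suml.
rewrite exchange_big/=; apply: eq_bigr => i _.
rewrite mxE mulr_suml; apply: eq_bigr => k _.
by rewrite !mxE -!mulrA mulVf ?weight_neq0// mulr1 mulrCA.
Qed.

Lemma kms_adj_incl n (b : 'M[C]_(2 ^ n.+1)) :
  kms_adj (incl b) = incl (kms_adj b).
Proof.
apply: kron_index_mxP => i p j q; rewrite mxE !kronE !mxE !weight_kron_index eq_sym.
case: eqVneq => [->|_]; last by rewrite !mulr0 rmorph0 !mul0r.
rewrite !mulr1 [X in _ / X]mulrC invfM !mulrA.
by rewrite mulfK ?weight_neq0.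
Qed.

Lemma level_state_riesz n (L : 'M[C]_(2 ^ n.+1) -> C) : scalar L ->
  exists c, forall x, L x = tau (c *m x).
Proof.
move=> Lin.
exists (\matrix_(b, a) (L (delta_mx a b) / weight b)) => x.
rewrite level_stateE {1}(matrix_sum_delta x) (lin_sum Lin).
under eq_bigr do rewrite (lin_sum Lin).
rewrite exchange_big/=; apply: eq_bigr => b _.
rewrite mxE mulr_suml; apply: eq_bigr => a _.
by rewrite (linZ Lin)/= mxE mulrAC divfK ?weight_neq0// mulrC.
Qed.

End product_state.

(** * The shell enumeration *)

Section shell_enumeration.
Local Open Scope nat_scope.

(** The shell number with rows, columns and values all counted from 0. *)
Definition shell0 (a b : nat) : nat := (shell a.+1 b.+1).-1.

Lemma shell0_le a b : a <= b -> shell0 a b = b * b + a.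
Proof. by move=> ab; rewrite /shell0 /shell ltnS ab /= -mulnn addnS. Qed.

Lemma shell0_gt a b : b < a -> shell0 a b = a * a + a + (a - b).
Proof. move=> ba; rewrite /shell0 /shell ltnS leqNgt ba /= -mulnn; nia. Qed.

(** Shell number [t], where [t] is the larger of row and column, occupies the
    integers between [t ^ 2] and [(t + 1) ^ 2]. *)
Lemma shell0_bounds a b :
  maxn a b * maxn a b <= shell0 a b < (maxn a b).+1 * (maxn a b).+1.
Proof.
by have [ab|ba] := leqP a b; rewrite ?(shell0_le ab) ?(shell0_gt ba); nia.
Qed.

Lemma sqr_floor_uniq t t' m : t * t <= m < t.+1 * t.+1 ->
  t' * t' <= m < t'.+1 * t'.+1 -> t = t'.
Proof. by nia. Qed.

Lemma sqr_floor m : exists t, t * t <= m < t.+1 * t.+1.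
Proof.
elim: m => [|m [t /andP[tm mt]]]; first by exists 0.
have [mt'|mt'] := ltnP m.+1 (t.+1 * t.+1); first by exists t; lia.
by exists t.+1; nia.
Qed.

Lemma shell0_inj a b a' b' : shell0 a b = shell0 a' b' -> a = a' /\ b = b'.
Proof.
move=> e; have := sqr_floor_uniq (shell0_bounds a b); rewrite e.
move=> /(_ _ (shell0_bounds a' b')) tt'; move: e.
have [ab|ba] := leqP a b; have [ab'|ba'] := leqP a' b';
  rewrite ?(shell0_le ab) ?(shell0_gt ba) ?(shell0_le ab') ?(shell0_gt ba');
  move: tt'; rewrite /maxn; case: ifP; case: ifP; nia.
Qed.

Lemma shell0_surj d m : m < d * d -> exists a b, [/\ a < d, b < d & shell0 a b = m].
Proof.
have [t /andP[tm mt]] := sqr_floor m; move=> md.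
have td : t < d by nia.
have [le|gt] := leqP (m - t * t) t.
  by exists (m - t * t), t; rewrite shell0_le//; split=> //; nia.
exists t, (t * t + t + t - m); rewrite shell0_gt; last by nia.
by split=> //; nia.
Qed.

(** With [t ^ 2 <= K < (t + 1) ^ 2], the entries numbered below [K] fill the square
    of size [t], a piece of column [t] and a piece of row [t]; each of the three is a
    rectangle. *)
Lemma shell0_initial K : exists P Q : 'I_3 -> pred nat, forall a b,
  (shell0 a b < K) = \sum_(i < 3) (P i b && Q i a) :> nat.
Proof.
have [t /andP[tK Kt]] := sqr_floor K.
exists (fun i b => nth false [:: b < t; b == t; (b < t) && (t * t + t + t < K + b)] i).
exists (fun i a => nth false [:: a < t; (a <= t) && (t * t + a < K); a == t] i).
move=> a b; rewrite !big_ord_recl big_ord0 /= /bump /=.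
have [ab|ba] := leqP a b; rewrite ?(shell0_le ab) ?(shell0_gt ba).
  have -> : (b * b + a < K) = (b < t) || ((b == t) && (t * t + a < K)).
    by have [bt|bt|bt] := ltngtP b t => /=; nia.
  by have [bt|bt|bt] := ltngtP b t => /=; have [at_|at_|at_] := ltngtP a t => /=;
    rewrite ?andbF ?addn0 ?andbT//=; lia.
have -> : (a * a + a + (a - b) < K) =
    (a < t) || ((a == t) && (t * t + t + t < K + b)).
  by have [at_|at_|at_] := ltngtP a t => /=; nia.
by have [bt|bt|bt] := ltngtP b t => /=; have [at_|at_|at_] := ltngtP a t => /=;
  rewrite ?andbF ?addn0 ?andbT//=; lia.
Qed.

End shell_enumeration.

(** * Orthogonality and completeness of the Haar matrices *)

Lemma big_nat_add (V : zmodType) (F : nat -> V) a b :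
  \sum_(0 <= j < a + b) F j = \sum_(0 <= j < a) F j + \sum_(0 <= k < b) F (a + k)%N.
Proof.
rewrite (big_cat_nat (n := a)) ?leq_addr//=; congr (_ + _).
by rewrite -{1}[a]add0n big_addn addKn; apply: eq_bigr => k _; rewrite addnC.
Qed.

Lemma big_nat_blocks (V : zmodType) (F : nat -> V) N q :
  \sum_(0 <= j < N * q) F j =
  \sum_(0 <= p < q) \sum_(0 <= k < N) F (N * p + k)%N.
Proof.
elim: q => [|q IH]; first by rewrite muln0 !big_nil.
by rewrite mulnSr big_nat_add IH big_nat_recr.
Qed.

Section biorthogonal.
Variables (F : fieldType) (d : nat).

(** [d ^ 2] matrices with a biorthogonal family of functionals form a basis,
    since a one-sided inverse of a square matrix is two-sided. *)
Lemma biorthogonal_complete (g : nat -> 'M[F]_d) (L : nat -> 'M[F]_d -> F) :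
  (forall j, scalar (L j)) ->
  (forall j k, (j < d * d)%N -> (k < d * d)%N -> L j (g k) = (j == k)%:R) ->
  forall z, \sum_(0 <= j < d * d) L j z *: g j = z.
Proof.
move=> L_lin Lg z.
pose T : 'M[F]_(d * d) := \matrix_(j < d * d) mxvec (g j).
pose W : 'M[F]_(d * d) := \matrix_(i, j) L j (vec_mx (delta_mx 0 i)).
have mulW (v : 'rV[F]_(d * d)) j : (v *m W) 0 j = L j (vec_mx v).
  rewrite mxE {2}(row_sum_delta v) (linear_sum vec_mx) (lin_sum (L_lin j)).
  by apply: eq_bigr => i _; rewrite linearZ (linZ (L_lin j)) mxE.
have TW : T *m W = 1%:M.
  apply/row_matrixP => k; rewrite row_mul rowK; apply/rowP => j.
  by rewrite mulW mxvecK Lg// !mxE eq_sym.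
have /mulmx1C WT := TW.
apply: (can_inj mxvecK); rewrite linear_sum /= big_mkord.
rewrite -[RHS]mulmx1 -WT mulmxA mulmx_sum_row; apply: eq_bigr => j _.
by rewrite linearZ/= mulW mxvecK rowK.
Qed.

End biorthogonal.

Section haar_matrices.
Local Open Scope sesquilinear_scope.
Context {R : realType}.
Local Notation C := R[i].
Local Notation incl := Defs.incl.
Variable alpha : R.
Hypotheses (alpha_gt0 : 0 < alpha) (alpha_lt1 : alpha < 1).
Variable s : bool.

Local Notation tau := (level_state alpha).
Local Notation weight := (weight alpha).

(** The side of the system: in the left case ([s = true]) the product is the usual
    one, in the right case it is reversed. *)
Definition side_mulmx d (x y : 'M[C]_d) : 'M[C]_d := if s then x *m y else y *m x.

Lemma side_mulmx_linearl d (y : 'M[C]_d) : linear (fun x => side_mulmx x y).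
Proof.
move=> c x z; rewrite /side_mulmx; case: s; last by rewrite linearP.
by rewrite mulmxDl -scalemxAl.
Qed.

Definition side_form n (x y : 'M[C]_(2 ^ n.+1)) : C := tau (side_mulmx (x ^t*) y).

Lemma side_form_kron n (x x' : 'M[C]_(2 ^ n.+1)) (y y' : 'M[C]_2) :
  side_form (kron x y) (kron x' y') = side_form x x' * @side_form 0 y y'.
Proof.
by rewrite /side_form /side_mulmx; case: s; rewrite kron_adj kron_mul level_state_kron.
Qed.

Lemma adj_delta d (a b : 'I_d) : (delta_mx a b : 'M[C]_d) ^t* = delta_mx b a.
Proof. by apply/matrixP => i j; rewrite !mxE andbC rmorph_nat. Qed.

Lemma level_state_delta n (a b : 'I_(2 ^ n.+1)) :
  tau (delta_mx a b) = weight a *+ (a == b).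
Proof.
rewrite level_stateE (bigD1 a)//= big1 ?addr0 => [|i ia].
  by rewrite mxE eqxx /= eq_sym; case: eqP; rewrite ?mul1r ?mul0r// eq_sym.
by rewrite mxE (negPf ia) mul0r.
Qed.

Lemma side_form_delta n (a b c d : 'I_(2 ^ n.+1)) :
  side_form (delta_mx a b) (delta_mx c d) =
  weight (if s then b else a) *+ ((a == c) && (b == d)).
Proof.
rewrite /side_form /side_mulmx adj_delta; case: s; rewrite mul_delta_mx_cond.
  by case: eqP => _; rewrite ?mulr1n ?level_state_delta ?mulr0n ?linear0.
by rewrite eq_sym andbC; case: eqP => _; rewrite ?mulr1n ?level_state_delta//;
  rewrite ?mulr0n ?linear0// eq_sym; case: eqP => // ->.
Qed.

Lemma exp4_sqr n : (4 ^ n = 2 ^ n * 2 ^ n)%N.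
Proof. by rewrite -expnMn. Qed.

Lemma matrix_unitE n (a b : 'I_(2 ^ n.+1)) :
  matrix_unit n (shell0 a b) = delta_mx a b :> 'M[C]_(2 ^ n.+1).
Proof.
apply/matrixP => i j; rewrite !mxE -/(shell0 i j); congr (_%:R); congr nat_of_bool.
apply/eqP/andP => [/shell0_inj[ia jb]|[/eqP-> /eqP->]//].
by split; apply/eqP/val_inj.
Qed.

Lemma matrix_unitP n k : (k < 4 ^ n.+1)%N ->
  exists a b : 'I_(2 ^ n.+1), shell0 a b = k.
Proof.
rewrite exp4_sqr => /shell0_surj[a [b [ad bd <-]]].
by exists (Ordinal ad), (Ordinal bd).
Qed.

Lemma side_form_matrix_unit n k l : (k < 4 ^ n.+1)%N -> (l < 4 ^ n.+1)%N ->
  side_form (matrix_unit n k) (matrix_unit n l) =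
  side_form (matrix_unit n k) (matrix_unit n k) *+ (k == l).
Proof.
move=> /matrix_unitP[a [b <-]] /matrix_unitP[c [d <-]].
rewrite !matrix_unitE !side_form_delta !eqxx mulr1n; congr (_ *+ nat_of_bool _).
apply/andP/eqP => [[/eqP-> /eqP->]//|/shell0_inj[ac bd]].
by split; apply/eqP/val_inj.
Qed.

Lemma side_form_matrix_unit_gt0 n k : (k < 4 ^ n.+1)%N ->
  0 < side_form (matrix_unit n k) (matrix_unit n k).
Proof.
move=> /matrix_unitP[a [b <-]].
by rewrite !matrix_unitE !side_form_delta !eqxx mulr1n weight_gt0.
Qed.

(** Whichever side [s] prescribes, the weights cancel against the square norm of
    the matrix unit and leave the entry of [z] at the transposed position. *)
Lemma matrix_unit_partial_sum n (z : 'M[C]_(2 ^ n.+1)) K : (K <= 4 ^ n.+1)%N ->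
  \sum_(0 <= k < K) ((side_form (matrix_unit n k) (matrix_unit n k))^-1 *
     tau (side_mulmx z (matrix_unit n k))) *: (matrix_unit n k) ^t* =
  \matrix_(b, a) (z b a *+ (shell0 a b < K)%N).
Proof.
move=> KN; apply/matrixP => b a; rewrite summxE mxE.
transitivity (\sum_(0 <= k < K) (z b a *+ (shell0 a b == k))).
  apply: eq_big_nat => k /andP[_ kK].
  have [c [d cdk]] := matrix_unitP (leq_trans kK KN).
  rewrite -cdk matrix_unitE adj_delta side_form_delta !eqxx mulr1n mxE mxE.
  have zE : tau (side_mulmx z (delta_mx c d)) = z d c * weight (if s then d else c).
    rewrite /side_mulmx level_stateE; case: s.
      rewrite (bigD1 d)//= big1 ?addr0 => [|i id'].
        rewrite mxE (bigD1 c)//= big1 ?addr0 => [|j jc].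
          by rewrite mxE !eqxx mulr1.
        by rewrite mxE (negPf jc) mulr0.
      by rewrite mxE big1 ?mul0r// => j _; rewrite mxE (negPf id') andbF mulr0.
    rewrite (bigD1 c)//= big1 ?addr0 => [|i ic].
      rewrite mxE (bigD1 d)//= big1 ?addr0 => [|j jd].
        by rewrite mxE !eqxx mul1r.
      by rewrite mxE (negPf jd) andbF mul0r.
    by rewrite mxE big1 ?mul0r// => j _; rewrite mxE (negPf ic) mul0r.
  rewrite zE mulrCA mulVf ?weight_neq0// mulr1.
  have -> : (shell0 a b == shell0 c d) = (b == d) && (a == c).
    apply/eqP/andP => [/shell0_inj[ac bd]|[/eqP-> /eqP->]//].
    by split; apply/eqP/val_inj.
  case: eqP => [->|_] /=; last by rewrite mulr0.
  by case: eqP => [->|_] /=; rewrite ?mulr1 ?mulr0.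
rewrite sumrMnr; congr (_ *+ _).
elim: K {KN} => [|K IH]; first by rewrite big_nil.
rewrite big_nat_recr//= IH [in RHS]ltnS [in RHS]leq_eqVlt.
by case: (ltngtP (shell0 a b) K).
Qed.

Variable r : 'I_4 -> 'M[C]_2.
Hypothesis r0 : r ord0 = 1%:M.
Hypothesis r_orth : forall p q, @side_form 0 (r p) (r q) = (p == q)%:R.

(** The left tensor factor of a Haar matrix of the next level. *)
Definition haar_factor n (q : 'I_4) k : 'M[C]_(2 ^ n.+1) :=
  if q == ord0 then haar r n k else matrix_unit n k.

Lemma haarS n (q : 'I_4) k : (k < 4 ^ n.+1)%N ->
  haar r n.+1 (4 ^ n.+1 * q + k) = kron (haar_factor n q k) (r q).
Proof.
move=> kn; have n0 : (0 < 4 ^ n.+1)%N by rewrite expn_gt0.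
rewrite [haar r n.+1]/= -/(haar r n) /haar_factor.
rewrite (mulnC (4 ^ n.+1)%N) divnMDl// divn_small// addn0.
rewrite modnMDl modn_small// /Defs.incl !kron_mul mulmx1 !mul1mx.
rewrite -[q == ord0]val_eqE/=; case: eqP => [q0|_]; last by rewrite mulmx1 inord_val.
by congr (kron _ (r _)); apply/val_inj.
Qed.

Lemma haar_index n j : (j < 4 ^ n.+2)%N ->
  exists (q : 'I_4) k, (k < 4 ^ n.+1)%N /\ j = (4 ^ n.+1 * q + k)%N.
Proof.
move=> jn; have n0 : (0 < 4 ^ n.+1)%N by rewrite expn_gt0.
have q4 : (j %/ 4 ^ n.+1 < 4)%N by rewrite ltn_divLR// -expnS.
exists (Ordinal q4), (j %% 4 ^ n.+1)%N; rewrite ltn_mod n0; split=> //.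
by rewrite /= mulnC -divn_eq.
Qed.

Definition haar_sqnorm n j : C := side_form (haar r n j) (haar r n j).

(** Both the state and the matrices factor at each level, and the orthonormality of
    the [r_q] separates the four quarters of the index range. *)
Lemma haar_orthogonal n j k : (j < 4 ^ n.+1)%N -> (k < 4 ^ n.+1)%N ->
  0 < haar_sqnorm n j /\ side_form (haar r n j) (haar r n k) = haar_sqnorm n j *+ (j == k).
Proof.
rewrite /haar_sqnorm; elim: n j k => [|n IH] j k jn kn.
  rewrite /= !r_orth eqxx ltr01; split=> //; congr (nat_of_bool _)%:R.
  by rewrite -val_eqE /= !inordK.
have [p [j' [jn' ->]]] := haar_index jn; have [q [k' [kn' ->]]] := haar_index kn.
rewrite !haarS// !side_form_kron !r_orth eqxx mulr1.
have -> : (4 ^ n.+1 * p + j' == 4 ^ n.+1 * q + k')%N = (j' == k') && (p == q).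
  have n0 : (0 < 4 ^ n.+1)%N by rewrite expn_gt0.
  apply/eqP/andP => [e|[/eqP-> /eqP->]//].
  have := congr1 (modn^~ (4 ^ n.+1)%N) e; have := congr1 (divn^~ (4 ^ n.+1)%N) e.
  rewrite /= ![(4 ^ n.+1 * _)%N]mulnC !divnMDl// !divn_small// !addn0.
  by rewrite !modnMDl !modn_small// => /val_inj-> ->.
rewrite /haar_factor andbC; case: (eqVneq p q) => [->|_] /=; last first.
  rewrite mulr0 mulr0n; split=> //; case: eqP => _; first by case: (IH j' j' jn' jn').
  exact: side_form_matrix_unit_gt0.
rewrite mulr1; case: eqP => _; first exact: IH.
by split; [exact: side_form_matrix_unit_gt0|exact: side_form_matrix_unit].
Qed.

Lemma haar_sqnorm_gt0 n j : (j < 4 ^ n.+1)%N -> 0 < haar_sqnorm n j.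
Proof. by move=> jn; have [] := haar_orthogonal jn jn. Qed.

Lemma haar_sqnormS n (q : 'I_4) k : (k < 4 ^ n.+1)%N ->
  haar_sqnorm n.+1 (4 ^ n.+1 * q + k) = side_form (haar_factor n q k) (haar_factor n q k).
Proof. by move=> kn; rewrite /haar_sqnorm haarS// side_form_kron r_orth eqxx mulr1. Qed.

Lemma haar_complete n (z : 'M[C]_(2 ^ n.+1)) :
  \sum_(0 <= j < 4 ^ n.+1) ((haar_sqnorm n j)^-1 * tau (side_mulmx z (haar r n j))) *:
    (haar r n j) ^t* = z.
Proof.
rewrite exp4_sqr.
apply: (biorthogonal_complete (g := fun j => (haar r n j) ^t*)
  (L := fun j z => (haar_sqnorm n j)^-1 * tau (side_mulmx z (haar r n j)))).
  by move=> j c x y; rewrite side_mulmx_linearl linearP/= mulrDr mulrCA.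
move=> j k; rewrite -exp4_sqr => jn kn.
have [k0 kj] := haar_orthogonal kn jn.
rewrite -[tau _]/(side_form _ _) kj eq_sym; case: eqVneq => [->|_]; last by rewrite mulr0.
by rewrite mulr1n mulVf// gt_eqF.
Qed.

Lemma haar_level n j : (j < 4 ^ n.+1)%N ->
  haar r n.+1 j = Defs.incl (haar r n j) /\ haar_sqnorm n.+1 j = haar_sqnorm n j.
Proof.
move=> jn; have := haarS ord0 jn; rewrite muln0 add0n => ->.
by have := haar_sqnormS ord0 jn; rewrite muln0 add0n /haar_factor eqxx r0.
Qed.

End haar_matrices.

(** * States of C*-algebras *)

Section complex_estimates.
Context {R : realType}.
Local Notation C := R[i].

Lemma gt0_complexP (e : C) : 0 < e -> exists2 r : R, 0 < r & e = r%:C%C.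
Proof.
move=> e0; have /complex_realP[r er] := gtr0_real e0; exists r => //.
by move: e0; rewrite er ltcR.
Qed.

Lemma half_expr_small (e : C) : 0 < e -> exists n, 2^-1 ^+ n < e.
Proof.
move=> /gt0_complexP[r r0 ->].
have [n nr] : exists n : nat, r^-1 < n%:R.
  by exists (Num.trunc r^-1).+1; exact: truncnS_gt.
exists n.
have -> : (2^-1 : C) ^+ n = (2^-1 ^+ n)%:C%C by rewrite rmorphXn fmorphV rmorph_nat.
rewrite ltcR exprVn invf_plt ?posrE ?exprn_gt0// (lt_trans nr)//.
by rewrite -natrX ltr_nat ltn_expl.
Qed.

(** Besides the limit, a bound for the distance to it; the modulus [b] need only
    come close to 0. *)
Lemma cauchy_modulus_lim (V : completeNormedModType C) (u : nat -> V)
    (b : nat -> C) :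
  (forall e, 0 < e -> exists n, b n < e) ->
  (forall n m, (n <= m)%N -> `|u m - u n| <= b n) ->
  exists l, forall n, `|l - u n| <= b n.
Proof.
move=> b0 ub.
have cu : cvg (u @ \oo).
  apply/cauchy_cvgP/cauchy_exP => e e0; have [n bn] := b0 e e0.
  exists (u n); exists n => // m /= nm; rewrite -ball_normE /ball_/= distrC.
  exact: le_lt_trans (ub _ _ nm) bn.
exists (lim (u @ \oo)) => n; apply/ler_addgt0Pr => e e0.
have /cvgrPdist_lt/(_ e e0)[m _ /(_ (maxn m n))] := cu.
rewrite /= leq_maxl => /(_ isT) ule.
rewrite -[_ - u n](subrKA (u (maxn m n))) addrC (le_trans (ler_normD _ _))//.
by rewrite lerD ?(ltW ule)// ub// leq_maxr.
Qed.

End complex_estimates.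

Section cstar_positivity.
Context {R : realType} {A : cstarType R}.
Local Notation C := R[i].
Implicit Types a x y : A.

Let mulBl x y z : cmul (x - y) z = cmul x z - cmul y z.
Proof. exact: (linB (s := GRing.scale) (cmul_linearl z)). Qed.
Let mulBr x y z : cmul x (y - z) = cmul x y - cmul x z.
Proof. exact: (linB (s := GRing.scale) (cmul_linearr x)). Qed.

Lemma starD x y : star (x + y) = star x + star y.
Proof. by have := star_semilinear 1 x y; rewrite !scale1r rmorph1 scale1r. Qed.

Lemma star0 : star (0 : A) = 0.
Proof. by apply: (addrI (star 0)); rewrite -starD !addr0. Qed.

Lemma starZ (c : C) x : star (c *: x) = Num.conj c *: star x.
Proof. by have := star_semilinear c x 0; rewrite star0 !addr0. Qed.

Lemma starN x : star (- x) = - star x.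
Proof. by rewrite -scaleN1r starZ rmorphN1 scaleN1r. Qed.

Lemma norm_star x : `|star x| = `|x|.
Proof.
have le y : `|y| <= `|star y|.
  have [->|y0] := eqVneq y 0; first by rewrite star0.
  have ny : 0 < `|y| by rewrite normr_gt0.
  by rewrite -(ler_pM2r ny) -expr2 -star_norm cmul_norm.
by apply/eqP; rewrite eq_le le -{2}(starK x) le.
Qed.

(** The element [1 - y] is a square root of [1 - x] when [y = (x + y ^ 2) / 2], and
    the right-hand side is a contraction of the ball of radius [1 / 2].  This makes
    [1 - x] positive without any spectral theory. *)
Lemma one_minus_square x : star x = x -> `|x| <= 2^-1 ->
  exists2 y, star y = y & cone - x = cmul (cone - y) (cone - y).
Proof.
move=> sx nx.
pose F y : A := 2^-1 *: (x + cmul y y).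
pose u := fix u n := if n is m.+1 then F (u m) else 0.
have h0 : (0 : C) <= 2^-1 by rewrite invr_ge0.
have FB y z : F y - F z = 2^-1 *: (cmul y (y - z) + cmul (y - z) z).
  rewrite /F -scalerBr mulBl mulBr; congr (_ *: _).
  by rewrite opprD addrACA subrr add0r addrA subrK.
have Flip y z : `|y| <= 2^-1 -> `|z| <= 2^-1 -> `|F y - F z| <= 2^-1 * `|y - z|.
  move=> ny nz; rewrite FB normrZ ger0_norm// ler_wpM2l//.
  rewrite (le_trans (ler_normD _ _))//.
  rewrite -[leRHS]mul1r (splitr 1) mul1r mulrDl lerD//.
    by rewrite (le_trans (cmul_norm _ _))// ler_wpM2r.
  by rewrite (le_trans (cmul_norm _ _))// mulrC ler_wpM2r.
have un n : `|u n| <= 2^-1.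
  elim: n => [|n IH] /=; first by rewrite normr0.
  rewrite normrZ ger0_norm// -[leRHS]mulr1 ler_wpM2l// (splitr 1) mul1r.
  rewrite (le_trans (ler_normD _ _))// lerD// (le_trans (cmul_norm _ _))//.
  by rewrite (le_trans (ler_pM _ _ IH IH))// ler_piMl// invf_le1// ler1n.
have du n : `|u n.+1 - u n| <= 2^-1 ^+ n.+1.
  elim: n => [|n IH]; first by rewrite subr0 expr1 un.
  rewrite exprS (le_trans (Flip (u n.+1) (u n) (un _) (un _)))//.
  exact: ler_wpM2l.
have duk n k : `|u (n + k)%N - u n| <= 2^-1 ^+ n - 2^-1 ^+ (n + k).
  elim: k => [|k IH]; first by rewrite addn0 !subrr normr0.
  rewrite addnS -(subrKA (u (n + k)%N)) (le_trans (ler_normD _ _))//.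
  rewrite (le_trans (lerD (du _) IH))//.
  by rewrite le_eqVlt; apply/orP; left; apply/eqP; rewrite exprS; field.
have [y uy] : exists y, forall n, `|y - u n| <= 2^-1 ^+ n.
  apply: cauchy_modulus_lim; first exact: half_expr_small.
  move=> n m nm; rewrite -(subnKC nm) (le_trans (duk _ _))// gerBl.
  by rewrite exprn_ge0.
have ny : `|y| <= 2^-1.
  apply/ler_addgt0Pr => e e0; have [n ne] := half_expr_small e0.
  rewrite -(subrK (u n) y) (le_trans (ler_normD _ _))// addrC lerD//.
  exact: le_trans (uy n) (ltW ne).
have su n : star (u n) = u n.
  elim: n => [|n IH] /=; first by rewrite star0.
  by rewrite /F starZ starD starM IH sx fmorphV rmorph_nat.
have small (z : A) : (forall n, `|z| <= 2 * 2^-1 ^+ n) -> z = 0.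
  move=> zn; apply/normr0_eq0/eqP; rewrite eq_le normr_ge0 andbT.
  apply/ler_addgt0Pr => e e0; rewrite add0r.
  have [n ne] := half_expr_small (divr_gt0 e0 (ltr0n C 2)).
  by rewrite (le_trans (zn n))// mulrC -ler_pdivlMr// ltW.
exists y.
  apply/eqP; rewrite -subr_eq0; apply/eqP/small => n.
  rewrite -(subrKA (u n)) -{1}(su n) -starN -starD.
  rewrite (le_trans (ler_normD _ _))// mulr_natl mulr2n lerD// ?norm_star//.
  by rewrite distrC.
have yF : y = F y.
  apply/eqP; rewrite -subr_eq0; apply/eqP/small => n.
  rewrite -(subrKA (u n.+1)) (le_trans (ler_normD _ _))// mulr_natl mulr2n.
  rewrite lerD//.
    by rewrite (le_trans (uy _))// exprS ler_piMl ?exprn_ge0// invf_le1// ler1n.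
  rewrite distrC (le_trans (Flip _ _ _ _))// (le_trans _ (uy n))//.
  by rewrite ler_piMl// invf_le1// ler1n.
rewrite mulBl !mulBr cmul1l cmul1r !cmul1l opprB.
have -> : x = y + y - cmul y y.
  apply/eqP; rewrite eq_sym subr_eq {1 2}yF -scalerDl -(mulr1 2^-1) -mulrDr.
  by rewrite mulVf ?pnatr_eq0// scale1r.
by rewrite !opprD opprK !addrA addrAC.
Qed.

Lemma star_cone : star (cone : A) = cone.
Proof. by rewrite -[LHS]cmul1l -{1}(starK cone) -starM cmul1l starK. Qed.

(** A state is nonnegative at [1 - x], where [x] is [a^* a] scaled to norm [1 / 2];
    the factor 2 comes from this scaling. *)
Lemma state_bound (rho : A -> C) a : state rho ->
  rho (cmul (star a) a) <= 2 * `|a| ^+ 2.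
Proof.
move=> [rho_lin rho_pos rho1].
have [->|a0] := eqVneq a 0.
  have -> : cmul (star 0) (0 : A) = 0.
    by rewrite (lin0 (s := GRing.scale) (cmul_linearr _)).
  by rewrite (lin0 rho_lin) normr0 expr0n mulr0.
pose c : C := (2 * `|a| ^+ 2)^-1.
have b0 : 0 < 2 * `|a| ^+ 2 :> C by rewrite mulr_gt0 ?exprn_gt0 ?normr_gt0.
have c0 : 0 < c by rewrite invr_gt0.
pose x := c *: cmul (star a) a.
have sx : star x = x.
  by rewrite starZ starM starK conj_Creal// realE ltW.
have nx : `|x| <= 2^-1.
  rewrite normrZ gtr0_norm// star_norm /c invfM -mulrA mulVf ?mulr1//.
  by rewrite expf_neq0 ?normr_eq0.
have [y sy xy] := one_minus_square sx nx.
have : 0 <= rho (cone - x).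
  by rewrite xy -{1}sy -{1}star_cone -starN -starD rho_pos.
rewrite (linB rho_lin) rho1 subr_ge0 (linZ rho_lin)/= /c mulrC.
by rewrite ler_pdivrMr// mul1r.
Qed.

End cstar_positivity.

(** * Operators on a Hilbert space *)

Section hilbert.
Context {R : realType} {H : hilbertType R}.
Local Notation C := R[i].
Implicit Types (u v : H) (S T : bop H).

Lemma dotC u v : dot u v = (dot v u)^*.
Proof. by rewrite hermC expr0 mul1r. Qed.

Lemma dotDl u v w : dot (u + v) w = dot u w + dot v w.
Proof. exact: linearDl. Qed.
Lemma dotBl u v w : dot (u - v) w = dot u w - dot v w.
Proof. exact: linearBl. Qed.
Lemma dotBr u v w : dot u (v - w) = dot u v - dot u w.
Proof. exact: linearBr. Qed.
Lemma dotZl (c : C) u v : dot (c *: u) v = c * dot u v.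
Proof. exact: linearZl_LR. Qed.
Lemma dotZr (c : C) u v : dot u (c *: v) = c^* * dot u v.
Proof. exact: linearZr_LR. Qed.
Lemma dot0r u : dot u 0 = 0. Proof. exact: linear0r. Qed.

Lemma cauchy_schwarz u v : `|dot u v| <= `|u| * `|v|.
Proof.
have [->|v0] := eqVneq v 0; first by rewrite dot0r !normr0 mulr0.
have nv : 0 < `|v| by rewrite normr_gt0.
have v2 : 0 < `|v| ^+ 2 by rewrite exprn_gt0.
pose c := dot u v / `|v| ^+ 2.
have : 0 <= dot (u - c *: v) (u - c *: v) by rewrite dot_norm exprn_ge0.
rewrite dotBl !dotBr !dotZl !dotZr !dot_norm (dotC v u).
rewrite /c rmorphM /= (_ : (_^-1)^* = (`|v| ^+ 2)^-1); last first.
  by rewrite fmorphV/= conj_Creal// realE ltW.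
rewrite divfK ?gt_eqF// subrr subr0 mulrAC (mulrC _^* ) -normCK.
rewrite subr_ge0 ler_pdivrMr// -exprMn.
by rewrite ler_pXn2r// nnegrE ?mulr_ge0.
Qed.

Lemma bop_lin T : linear T. Proof. by have [] := bopP T. Qed.

Lemma bopDE S T u : (S + T) u = S u + T u. Proof. by []. Qed.
Lemma bopBE S T u : (S - T) u = S u - T u. Proof. by []. Qed.
Lemma bopZE (c : C) T u : (c *: T) u = c *: T u. Proof. by []. Qed.
Lemma bop_sumE I (r : seq I) (P : pred I) (F : I -> bop H) u :
  (\sum_(i <- r | P i) F i) u = \sum_(i <- r | P i) F i u.
Proof. exact: (big_morph (fun T : bop H => T u)). Qed.

Lemma bop_bound T : exists2 c : C, 0 < c & forall u, `|T u| <= c * `|u|.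
Proof.
have [_ [c Tc]] := bopP T; exists (`|c| + 1) => [|u]; first by rewrite ltr_wpDl.
have [u0|u0] := eqVneq `|u| 0.
  by rewrite (le_trans (Tc u))// u0 !mulr0.
have ugt0 : 0 < `|u| by rewrite lt_def u0 normr_ge0.
have c0 : 0 <= c by rewrite -(pmulr_lge0 _ ugt0) (le_trans _ (Tc u)).
by rewrite (le_trans (Tc u))// ler_wpM2r// (ger0_norm c0) lerDl.
Qed.

Lemma closure_approx (V : normedModType C) (D : set V) (u : V) (e : C) :
  closure D = setT -> 0 < e ->
  exists2 v, D v & `|u - v| < e.
Proof.
move=> DT e0; have : closure D u by rewrite DT.
move=> /(_ _ (nbhsx_ballx u e e0))[v [Dv]]; rewrite -ball_normE => uv.
by exists v.
Qed.

Lemma small_norm_eq0 {V : normedModType C} (K : C) (v : V) :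
  (forall e : C, 0 < e -> `|v| <= K * e) -> v = 0.
Proof.
move=> ve; have K0 : 0 <= K by rewrite -[K]mulr1 (le_trans _ (ve 1 ltr01)).
apply/normr0_eq0/eqP; rewrite eq_le normr_ge0 andbT.
apply/ler_addgt0Pr => e e0; rewrite add0r.
have K1 : 0 < K + 1 by rewrite ltr_wpDl.
rewrite (le_trans (ve _ (divr_gt0 e0 K1)))// mulrCA ler_piMr ?(ltW e0)//.
by rewrite ler_pdivrMr// mul1r lerDl.
Qed.

Definition bounded_by (T : bop H) (k : C) : Prop := forall u, `|T u| <= k * `|u|.

Lemma bounded_by_comp (S T : bop H) k l : 0 <= k ->
  bounded_by S k -> bounded_by T l -> bounded_by (bop_comp S T) (k * l).
Proof.
move=> k0 Sk Tl u; rewrite /= (le_trans (Sk _))// -mulrA ler_wpM2l//.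
Qed.

Lemma bounded_byD (S T : bop H) k l :
  bounded_by S k -> bounded_by T l -> bounded_by (S + T) (k + l).
Proof.
move=> Sk Tl u; rewrite bopDE (le_trans (ler_normD _ _))// mulrDl lerD//.
Qed.

Lemma bounded_byZ (c : C) (T : bop H) k :
  bounded_by T k -> bounded_by (c *: T) (`|c| * k).
Proof. by move=> Tk u; rewrite bopZE normrZ -mulrA ler_wpM2l. Qed.

Lemma bounded_by_sum I (r : seq I) (P : pred I) (F : I -> bop H) (k : I -> C) :
  (forall i, P i -> bounded_by (F i) (k i)) ->
  bounded_by (\sum_(i <- r | P i) F i) (\sum_(i <- r | P i) k i).
Proof.
move=> Fk u; rewrite bop_sumE (le_trans (ler_norm_sum _ _ _))// mulr_suml ler_sum//.
by move=> i /Fk.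
Qed.

Lemma bounded_byW (T : bop H) k l : k <= l -> bounded_by T k -> bounded_by T l.
Proof. by move=> kl Tk u; rewrite (le_trans (Tk u))// ler_wpM2r. Qed.

Section bounded_extension.
Variables (Gr : H -> H -> Prop) (K : C).
Hypothesis K0 : 0 <= K.
Hypothesis Gr_lin : forall c u v u' v',
  Gr u v -> Gr u' v' -> Gr (c *: u + u') (c *: v + v').
Hypothesis Gr_bound : forall u v, Gr u v -> `|v| <= K * `|u|.
Hypothesis Gr_dense : forall u (e : C), 0 < e ->
  exists u' v', Gr u' v' /\ `|u - u'| < e.

Let Gr_dist u v u' v' : Gr u v -> Gr u' v' -> `|v - v'| <= K * `|u - u'|.
Proof.
move=> uv uv'; have := Gr_lin (-1) uv' uv.
by rewrite !scaleN1r ![- _ + _]addrC; exact: Gr_bound.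
Qed.

Let Gr_lim u : exists w, forall u' v', Gr u' v' -> `|w - v'| <= K * `|u - u'|.
Proof.
have /choice[p pP] n : exists p : H * H, Gr p.1 p.2 /\ `|u - p.1| < 2^-1 ^+ n.
  have h : 0 < (2^-1 : C) ^+ n by rewrite exprn_gt0 ?invr_gt0.
  by have [u' [v' uv']] := Gr_dense u h; exists (u', v').
pose b n : C := (K * 2) * 2^-1 ^+ n.
have b_small (e : C) : 0 < e -> exists n, b n < e.
  move=> e0; have K1 : 0 < K * 2 + 1 by rewrite ltr_wpDl// mulr_ge0.
  have [n ne] := half_expr_small (divr_gt0 e0 K1); exists n.
  rewrite ltr_pdivlMr// mulrC in ne; apply: le_lt_trans ne.
  by rewrite ler_wpM2r ?exprn_ge0// lerDl.
have [w wP] : exists w, forall n, `|w - (p n).2| <= b n.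
  apply: cauchy_modulus_lim => // n m nm.
  have [[Gm um] [Gn un]] := (pP m, pP n).
  rewrite (le_trans (Gr_dist Gm Gn))// /b -mulrA ler_wpM2l// mulr_natl mulr2n.
  rewrite -(subrKA u) (le_trans (ler_normD _ _))// lerD ?(ltW un)// distrC.
  by rewrite (le_trans (ltW um))// ler_wiXn2l// ?invr_ge0// invf_le1// ler1n.
exists w => u' v' uv'; apply/ler_addgt0Pr => e e0.
have [n ne] := b_small _ (divr_gt0 e0 (ltr0n C 2)); have [Gn un] := pP n.
rewrite -(subrKA (p n).2) (le_trans (ler_normD _ _))// [leRHS]addrC (splitr e).
rewrite -addrA lerD//; first exact: le_trans (wP n) (ltW ne).
rewrite (le_trans (Gr_dist Gn uv'))//.
rewrite -(subrKA u) (le_trans (ler_wpM2l K0 (ler_normD _ _)))// mulrDr.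
rewrite lerD2r distrC (le_trans _ (ltW ne))// /b -mulrA ler_wpM2l//.
by rewrite (le_trans (ltW un))// ler_peMl ?exprn_ge0 ?invr_ge0// ler1n.
Qed.

(** The values of a densely defined bounded linear relation converge along any
    approximation of the argument, so the relation extends to an operator. *)
Lemma bounded_extension : exists T : bop H, forall u v, Gr u v -> T u = v.
Proof.
have /choice[T TP] := Gr_lim.
have T_lin : linear T.
  move=> c u v; apply/eqP; rewrite -subr_eq0; apply/eqP.
  apply: (@small_norm_eq0 _ ((K * (`|c| + 1)) *+ 2)) => e e0.
  have [u' [x [Gu ux]]] := Gr_dense u e0; have [v' [y [Gv vy]]] := Gr_dense v e0.
  rewrite -(subrKA (c *: x + y)) (le_trans (ler_normD _ _))// mulrnAl mulr2n.
  have est (z z' : H) : `|z| <= e -> `|z'| <= e -> `|c *: z + z'| <= (`|c| + 1) * e.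
    move=> ze ze'; rewrite (le_trans (ler_normD _ _))// mulrDl mul1r lerD//.
    by rewrite normrZ ler_wpM2l.
  rewrite -mulrA lerD//.
    rewrite (le_trans (TP _ _ _ (Gr_lin c Gu Gv)))// ler_wpM2l//.
    rewrite (_ : _ - _ = c *: (u - u') + (v - v')); first by rewrite est// ltW.
    by rewrite scalerBr opprD addrACA.
  rewrite (_ : _ - _ = c *: (x - T u) + (y - T v)); last first.
    by rewrite scalerBr opprD addrACA.
  rewrite (le_trans (ler_normD _ _))// mulrDl mul1r mulrDr lerD//.
    rewrite normrZ mulrCA ler_wpM2l// distrC (le_trans (TP _ _ _ Gu))//.
    by rewrite ler_wpM2l// ltW.
  by rewrite distrC (le_trans (TP _ _ _ Gv))// ler_wpM2l// ltW.
have Gr00 : Gr 0 0.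
  have [u [v [Guv _]]] := Gr_dense 0 ltr01.
  by have := Gr_lin (-1) Guv Guv; rewrite !scaleN1r !addNr.
have T_bnd : bounded_operator T.
  split=> //; exists K => u.
  by have := TP u _ _ Gr00; rewrite !subr0.
have Tin : T \in bounded_operator_pred by apply/asboolP.
exists (Bop Tin) => u v Guv /=; apply/eqP; rewrite -subr_eq0 -normr_le0.
by rewrite (le_trans (TP _ _ _ Guv))// subrr normr0 mulr0.
Qed.

End bounded_extension.

Lemma bop_eqP (S T : bop H) : (forall u, S u = T u) -> S = T.
Proof. by move=> ST; apply/val_inj/funext. Qed.

Lemma bop_eq_dense (S T : bop H) (D : set H) :
  (forall u (e : C), 0 < e -> exists2 v, D v & `|u - v| < e) ->
  (forall v, D v -> S v = T v) -> S = T.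
Proof.
move=> Dd ST; apply: bop_eqP => u.
have [[c c0 Sc] [d d0 Td]] := (bop_bound S, bop_bound T).
apply/eqP; rewrite -subr_eq0; apply/eqP.
apply: (@small_norm_eq0 _ (c + d)) => e e0; have [v Dv uv] := Dd u e e0.
rewrite -(subrKA (S v)) {2}(ST v Dv) -!(linB (bop_lin _)).
rewrite (le_trans (ler_normD _ _))// mulrDl lerD//.
  by rewrite (le_trans (Sc _))// ler_wpM2l// ltW.
by rewrite (le_trans (Td _))// ler_wpM2l ?(ltW d0)// distrC ltW.
Qed.

(** Both sides are bounded in [u], so they agree as soon as they do on a dense set. *)
Lemma dot_dense (S : bop H) (D : set H) v w :
  (forall u (e : C), 0 < e -> exists2 v, D v & `|u - v| < e) ->
  (forall u, D u -> dot (S u) v = dot u w) -> forall u, dot (S u) v = dot u w.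
Proof.
move=> Dd Sw u; have [c c0 Sc] := bop_bound S.
apply/eqP; rewrite -subr_eq0; apply/eqP.
apply: (@small_norm_eq0 C^o (c * `|v| + `|w|)) => e e0.
have [u' Du' uu'] := Dd u e e0.
have -> : dot (S u) v - dot u w = dot (S (u - u')) v - dot (u - u') w.
  by rewrite (linB (bop_lin S)) !dotBl (Sw _ Du') opprB addrA subrK.
rewrite (le_trans (ler_normB _ _))// mulrDl lerD//.
  rewrite (le_trans (cauchy_schwarz _ _))// mulrAC ler_wpM2r//.
  by rewrite (le_trans (Sc _))// ler_wpM2l// ltW.
by rewrite (le_trans (cauchy_schwarz _ _))// mulrC ler_wpM2l// ltW.
Qed.

Lemma adjoint_dense (S T : bop H) (D : set H) :
  (forall u (e : C), 0 < e -> exists2 v, D v & `|u - v| < e) ->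
  (forall u v, D u -> D v -> dot (S u) v = dot u (T v)) ->
  forall u v, dot (S u) v = dot u (T v).
Proof.
move=> Dd ST u v.
rewrite dotC [RHS]dotC; congr (_^* ); symmetry; move: v.
apply: (dot_dense Dd) => v Dv; rewrite dotC [RHS]dotC; congr (_^* ); symmetry.
by move: u; apply: (dot_dense Dd) => u Du; exact: ST.
Qed.

Lemma orthogonal_dense0 (D : set H) u :
  (forall u (e : C), 0 < e -> exists2 v, D v & `|u - v| < e) ->
  (forall v, D v -> dot u v = 0) -> u = 0.
Proof.
move=> Dd uD; have [//|u0] := eqVneq u 0.
have haar_sqnorm : 0 < `|u| by rewrite normr_gt0.
have [v Dv uv] := Dd u _ haar_sqnorm.
have := cauchy_schwarz u (u - v); rewrite dotBr (uD v Dv) subr0 dot_norm.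
rewrite ger0_norm ?exprn_ge0// expr2 ler_pM2l// => le.
by have := le_lt_trans le uv; rewrite ltxx.
Qed.

End hilbert.

Section star_representations.
Context {R : realType} {A : cstarType R} {H : hilbertType R}.
Local Notation C := R[i].
Variable pi : A -> bop H.
Hypothesis pi_star : star_representation pi.

(** Vector functionals of unit vectors are states, hence [state_bound] applies. *)
Lemma star_representation_bound a (u : H) : `|pi a u| <= 2 * `|a| * `|u|.
Proof.
have [pi_lin pi_mul pi1 pi_adj] := pi_star.
have [->|u0] := eqVneq u 0.
  by rewrite (lin0 (bop_lin _)) normr0 mulr0.
have haar_sqnorm : 0 < `|u| by rewrite normr_gt0.
have u2 : 0 < `|u| ^+ 2 by rewrite exprn_gt0.
pose rho x := dot (pi x u) u / `|u| ^+ 2.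
have sq x : dot (pi (cmul (star x) x) u) u = `|pi x u| ^+ 2.
  by rewrite pi_mul /= pi_adj starK dot_norm.
have rho_state : state rho.
  split.
  - move=> c x y; rewrite /rho pi_lin.
    by rewrite -[bop_fun _ _]/(c *: pi x u + pi y u) dotDl dotZl mulrDl mulrA.
  - by move=> x; rewrite /rho sq divr_ge0 ?exprn_ge0.
  - by rewrite /rho pi1 /= dot_norm mulfV ?gt_eqF.
have := state_bound a rho_state; rewrite /rho sq ler_pdivrMr// => le.
rewrite -(@ler_pXn2r _ 2)// ?nnegrE ?mulr_ge0// !exprMn (le_trans le)//.
by rewrite ler_wpM2r ?(ltW u2)// ler_wpM2r ?exprn_ge0// ler_eXnr// ler1n.
Qed.

End star_representations.

(** * Schauder bases and normal functionals *)

Section schauder_criterion.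
Variables (K : numFieldType) (X : normedModType K).
Variables (e : nat -> X) (a : nat -> X -> K) (c : K).
Hypothesis a_lin : forall j, scalar (a j).
Hypothesis a_bound : forall j, exists k : K, forall x, `|a j x| <= k * `|x|.
Hypothesis a_dual : forall j k, a j (e k) = (j == k)%:R.
Hypothesis sums_bound : forall m x,
  `|\sum_(0 <= j < m) a j x *: e j| <= c * `|x|.
Hypothesis e_total : forall x (d : K), 0 < d ->
  exists N (b : nat -> K), `|x - \sum_(0 <= j < N) b j *: e j| < d.

(** On the span of the [e j] the partial sums are eventually constant; the uniform
    bound carries convergence over to the closure of the span.  The coefficients are
    unique because the [a j] are continuous. *)
Lemma schauder_criterion : schauder_basis e.
Proof.
have a_sum j N (b : nat -> K) : (j < N)%N -> a j (\sum_(0 <= k < N) b k *: e k) = b j.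
  move=> jN; rewrite (lin_sum (a_lin j)) (bigD1_seq j)/= ?mem_index_iota ?iota_uniq//.
  rewrite (linZ (a_lin j))/= a_dual eqxx mulr1 big1 ?addr0// => k kj.
  by rewrite (linZ (a_lin j))/= a_dual eq_sym (negPf kj) mulr0.
move=> x; exists (fun j => a j x); split.
  apply/cvgrPdist_le => d d0.
  have c0 : 0 < `|c| + 1 + 1 by rewrite ltr_wpDl// addr_ge0.
  have [N [b bx]] := e_total x (divr_gt0 d0 c0).
  exists N => // m /= Nm; pose y := \sum_(0 <= j < N) b j *: e j.
  have yE : y = \sum_(0 <= j < m) a j y *: e j.
    rewrite (big_cat_nat (n := N))//= [X in _ + X](_ : _ = 0) ?addr0.
      by rewrite {1}/y; apply: eq_big_nat => j /andP[_ jN]; rewrite a_sum.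
    rewrite big_nat big1// => j /andP[Nj _].
    rewrite (lin_sum (a_lin j)) big_nat big1 ?scale0r// => k /andP[_ kN].
    by rewrite (linZ (a_lin j))/= a_dual gtn_eqF ?mulr0// (leq_trans kN).
  rewrite -(subrKA y) (le_trans (ler_normD _ _))//.
  have -> : y - series (fun n => a n x *: e n) m = \sum_(0 <= j < m) a j (y - x) *: e j.
    rewrite {1}yE /series/= -sumrB; apply: eq_bigr => j _.
    by rewrite (linB (a_lin j)) scalerBl.
  rewrite (le_trans (lerD (lexx _) (sums_bound _ _)))//.
  have cn : c * `|y - x| = `|c| * `|y - x|.
    rewrite -[`|y - x| in RHS]normr_id -normrM ger0_norm//.
    exact: le_trans (sums_bound 0 _).
  rewrite cn distrC -[X in X + _]mul1r -mulrDl.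
  rewrite ltr_pdivlMr// in bx; rewrite distrC (le_trans _ (ltW bx))// mulrC.
  by rewrite ler_wpM2l// addrC lerDl.
move=> b bx; apply/funext => j.
have [k ak] := a_bound j.
apply/eqP; rewrite -subr_eq0; apply/eqP.
apply: (@normr0_eq0 K); apply/eqP; rewrite eq_le normr_ge0 andbT.
apply/ler_addgt0Pr => d d0; rewrite add0r.
have k0 : 0 < `|k| + 1 by rewrite ltr_wpDl.
move/cvgrPdist_lt: bx => /(_ _ (divr_gt0 d0 k0))[N _ /(_ (maxn N j.+1))].
rewrite /= leq_maxl => /(_ isT) xb.
rewrite -(@a_sum j (maxn N j.+1) b) ?leq_maxr// -(linB (a_lin j)).
have kE : k * `|x - series (fun n => b n *: e n) (maxn N j.+1)| =
    `|k| * `|x - series (fun n => b n *: e n) (maxn N j.+1)|.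
  rewrite -[`|_ - _| in RHS]normr_id -normrM ger0_norm//.
  exact: le_trans (ak _).
rewrite (le_trans (ak _))// kE.
rewrite ltr_pdivlMr// in xb; apply: ltW (le_lt_trans _ xb).
by rewrite mulrC ler_wpM2l// lerDl.
Qed.

End schauder_criterion.

Section kernel_induction.
Variables (K : fieldType) (V : lmodType K) (I : eqType) (L : I -> V -> K).
Variable P : (V -> K) -> Prop.
Hypothesis P0 : P (fun=> 0).
Hypothesis P_lin : forall (c : K) g h, P g -> P h -> P (fun y => c * g y + h y).

(** Subtracting a multiple of [L i] leaves a functional that vanishes on the common
    kernel of the others, so [phi] is a linear combination of the [L i].  As an
    induction principle this needs no coefficients. *)
Lemma kernel_induction (F : seq I) (phi : V -> K) : scalar phi ->
  (forall i, i \in F -> scalar (L i)) -> (forall i, i \in F -> P (L i)) ->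
  (forall y, (forall i, i \in F -> L i y = 0) -> phi y = 0) -> P phi.
Proof.
elim: F phi => [|i F IH] phi phi_lin LF_lin PL phi0.
  have -> : phi = fun=> 0 by apply/funext => y; apply: phi0.
  exact: P0.
have PF j : j \in F -> P (L j) by move=> jF; apply: PL; rewrite inE jF orbT.
have LF j : j \in F -> scalar (L j) by move=> jF; apply: LF_lin; rewrite inE jF orbT.
have Li : scalar (L i) by apply: LF_lin; rewrite mem_head.
have [[y0 [y0F y0i]]|no] :=
    pselect (exists y0, (forall j, j \in F -> L j y0 = 0) /\ L i y0 != 0).
  pose c := phi y0 / L i y0.
  have -> : phi = fun y => c * L i y + (phi y - c * L i y).
    by apply/funext => y; rewrite addrC subrK.
  apply: P_lin; first by apply: PL; rewrite mem_head.
  apply: IH => //.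
    by move=> d x y; rewrite phi_lin Li/=; ring.
  move=> y yF; pose z := y - (L i y / L i y0) *: y0.
  have : phi z = 0.
    apply: phi0 => j; rewrite inE => /orP[/eqP->|jF].
      by rewrite (linB Li) (linZ Li)/= divfK// subrr.
    by rewrite (linB (LF j jF)) (linZ (LF j jF))/= (yF j jF) (y0F j jF) mulr0 subrr.
  rewrite (linB phi_lin) (linZ phi_lin)/= => <-; congr (_ - _).
  by rewrite /c [LHS]mulrC mulrA mulrAC.
apply: IH => // y yF; apply: phi0 => j; rewrite inE => /orP[/eqP->|]; last exact: yF.
by apply/eqP/negPn/negP => yi; apply: no; exists y.
Qed.

End kernel_induction.

Section complex_completeness.
Context {R : realType}.
Local Notation C := R[i].

Lemma normc_le_ReIm (z : C) :
  `|z| <= (`|complex.Re z|)%:C%C + (`|complex.Im z|)%:C%C.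
Proof.
rewrite {1}[z]complexE (le_trans (ler_normD _ _))// normrM.
have nR (r : R) : `|r%:C%C| = `|r|%:C%C by rewrite normc_def /= expr0n addr0 sqrtr_sqr.
have -> : `|'i%C : C| = 1 by rewrite normc_def /= expr0n add0r expr1n sqrtr1.
by rewrite !nR mul1r.
Qed.

(** The completeness of [R[i]], coordinate by coordinate. *)
Lemma complex_cauchy_cvg (u : nat -> C) :
  (forall d : C, 0 < d -> exists N, forall m, (N <= m)%N -> `|u m - u N| <= d) ->
  cvg ((u : nat -> C^o) @ \oo).
Proof.
move=> uC.
have part (g : C -> R) : (forall z w, g (z - w) = g z - g w) ->
    (forall z, (`|g z|)%:C%C <= `|z|) -> cvg (g \o u @ \oo).
  move=> gB gle; apply/cauchy_cvgP/cauchy_exP => d d0.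
  have [|N uN] := uC (d / 2)%:C%C; first by rewrite ltcR divr_gt0.
  exists (g (u N)); exists N => // m /= Nm; rewrite -ball_normE /=.
  rewrite -ltcR -gB (le_lt_trans (gle _))// distrC (le_lt_trans (uN _ Nm))//.
  by rewrite ltcR ltr_pdivrMr// ltr_pMr// ltr1n.
have /(_ _ _) reC := part (@complex.Re R).
have imC := part (@complex.Im R).
have re_cvg : cvg (@complex.Re R \o u @ \oo).
  apply: reC; first by case=> ? ? [? ?].
  move=> z; exact: normc_ge_Re.
have im_cvg : cvg (@complex.Im R \o u @ \oo).
  apply: imC; first by case=> ? ? [? ?].
  by move=> [x y]; rewrite normc_def /= lecR -sqrtr_sqr ler_wsqrtr// lerDr sqr_ge0.
set x := lim (@complex.Re R \o u @ \oo) in re_cvg.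
set y := lim (@complex.Im R \o u @ \oo) in im_cvg.
apply/cvg_ex; exists (x +i* y)%C.
apply/cvgrPdist_le => d /gt0_complexP[r r0 ->].
have r2 : 0 < r / 2 by rewrite divr_gt0.
near=> n; rewrite (le_trans (normc_le_ReIm _))// -rmorphD lecR (splitr r).
rewrite lerD//.
  have -> : complex.Re ((x +i* y)%C - u n) = x - complex.Re (u n) by case: (u n).
  by near: n; move/cvgrPdist_le : re_cvg; exact.
have -> : complex.Im ((x +i* y)%C - u n) = y - complex.Im (u n) by case: (u n).
by near: n; move/cvgrPdist_le : im_cvg; exact.
Unshelve. all: by end_near. Qed.

End complex_completeness.

Section predual_functionals.
Context {R : realType} {H : hilbertType R} (S : set (bop H)).
Local Notation C := R[i].

Lemma contractiveP (x : vnalg S) : contractive x <-> bounded_by x 1.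
Proof. by split=> xc u; have := xc u; rewrite mul1r. Qed.

Let norm_normc (z : C) : `|z| = (Normc.normc z)%:C%C. Proof. by case: z. Qed.

Lemma predual_scalar (phi : predual S) : scalar (phi : vnalg S -> C).
Proof. by have [] := predualP phi. Qed.

Lemma predual_norm_contractive (phi : predual S) (x : vnalg S) :
  contractive x -> `|phi x : C| <= `|phi|.
Proof.
move=> x1; rewrite norm_normc -[`|phi|]/(predual_norm phi) lecR.
have [_ [c phic] _] := predualP phi.
apply: sup_upper_bound; last by exists x.
split; first by exists (Normc.normc (phi x)), x.
by exists c => _ [y y1 <-]; exact: phic.
Qed.

(** A slightly enlarged [k] can be divided out, which also covers [k = 0]. *)
Lemma predual_norm_bound (phi : predual S) (x : vnalg S) k : 0 <= k ->
  bounded_by x k -> `|phi x : C| <= k * `|phi|.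
Proof.
move=> k0 xk; apply/ler_addgt0Pr => e e0.
have phi0 : 0 < `|phi| + 1 by rewrite ltr_wpDl.
pose l := k + e / (`|phi| + 1).
have e'0 : 0 < e / (`|phi| + 1) by rewrite divr_gt0.
have l0 : 0 < l by rewrite ltr_wpDl.
have xl : contractive (l^-1 *: x).
  move=> u; rewrite -[X in `|X|]/(l^-1 *: x u) normrZ gtr0_norm ?invr_gt0//.
  by rewrite ler_pdivrMl// (le_trans (xk u))// ler_wpM2r// lerDl ltW.
have := predual_norm_contractive phi xl.
rewrite (linZ (predual_scalar phi))/= normrM gtr0_norm ?invr_gt0// ler_pdivrMl// => le.
rewrite (le_trans le)// /l mulrDl lerD2l mulrAC ler_pdivrMr//.
by rewrite ler_wpM2l ?(ltW e0)// lerDl.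
Qed.

Lemma predual_norm_le (phi : predual S) (c : C) :
  (forall x : vnalg S, contractive x -> `|phi x : C| <= c) -> `|phi| <= c.
Proof.
move=> phic.
have z1 : contractive (0 : vnalg S) by move=> u; rewrite normr0.
have c0 : 0 <= c by exact: le_trans (phic _ z1).
have /complex_realP[r rE] := ger0_real c0; rewrite rE.
rewrite -[`|phi|]/(predual_norm phi) lecR; apply: ge_sup.
  by exists (Normc.normc (phi 0)), 0.
by move=> _ [x x1 <-]; rewrite -lecR -norm_normc -rE phic.
Qed.

Definition vector_functional (xi eta : H) (x : vnalg S) : C^o := dot (x xi) eta.

Lemma vector_functional_normal xi eta : normal_functional (vector_functional xi eta).
Proof.
have lin : linear (vector_functional xi eta).
  by move=> c x y; rewrite /vector_functional dotDl dotZl.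
split=> //.
  have /complex_realP[r rE] := ger0_real (mulr_ge0 (normr_ge0 xi) (normr_ge0 eta)).
  exists r => x x1; rewrite -lecR -norm_normc -rE (le_trans (cauchy_schwarz _ _))//.
  by rewrite ler_wpM2r.
move=> x e e0.
(* the pair of sequences supported at index 0 pairs to [dot (x xi) eta] *)
pose single (z : H) n := if n is 0%N then z else 0.
exists [:: (single xi, single eta)].
  have sq z : square_summable (single z).
    apply/cvg_ex; exists (`|z| ^+ 2 : C^o).
    apply: cvg_near_cst; exists 1%N => // n /= n0.
    rewrite /series/= big_ltn// big_nat big1 ?addr0// => -[//|k] _.
    by rewrite normr0 expr0n.
  by move=> p; rewrite inE => /eqP ->; split; exact: sq.
exists e => // y; move=> /(_ _ (mem_head _ _)); apply: le_lt_trans.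
rewrite -(linB (s := GRing.scale) lin) le_eqVlt; apply/orP; left; apply/eqP.
congr (`|_|); rewrite /ultraweak_pairing /=. set u := series _.
have h : u @ \oo --> (vector_functional xi eta (y - x) : C^o).
  apply: cvg_near_cst; exists 1%N => // n /= n0.
  rewrite /u /series/= big_ltn// big_nat big1 ?addr0// => -[//|k] _.
  by rewrite dot0r.
by rewrite (cvg_lim (@norm_hausdorff _ _) h).
Qed.

End predual_functionals.

Section ultraweak.
Context {R : realType} {H : hilbertType R}.
Local Notation C := R[i].
Variable p : (nat -> H) * (nat -> H).
Hypotheses (sq1 : square_summable p.1) (sq2 : square_summable p.2).

Lemma square_summable_tail (xi : nat -> H) (d : C) : square_summable xi -> 0 < d ->
  exists N, forall n m, (N <= n)%N -> (N <= m)%N ->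
    `|\sum_(n <= k < m) `|xi k| ^+ 2| <= d.
Proof.
move=> /cvg_cauchy/cauchy_seriesP sq d0.
have [[P Q] /= [[N1 _ h1] [N2 _ h2]] PQ] := sq d d0.
exists (maxn N1 N2) => n m; rewrite !geq_max => /andP[n1 n2] /andP[m1 m2].
by apply/ltW/(PQ (n, m)); split; [exact: h1|exact: h2].
Qed.

(** By Cauchy-Schwarz and [a b <= a ^ 2 + b ^ 2], the tails are controlled by those
    of the two square sums, uniformly over the operators of norm at most [c]. *)
Lemma pairing_tail (d : C) : 0 < d -> exists N, forall (T : bop H) c m, 0 <= c ->
  bounded_by T c -> (N <= m)%N ->
  `|\sum_(N <= k < m) dot (T (p.1 k)) (p.2 k)| <= c * d.
Proof.
move=> d0; have d2 : 0 < d / 2 by rewrite divr_gt0.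
have [N1 h1] := square_summable_tail sq1 d2.
have [N2 h2] := square_summable_tail sq2 d2.
exists (maxn N1 N2) => T c m c0 Tc Nm.
have {}h1 := h1 (maxn N1 N2) m (leq_maxl _ _) (leq_trans (leq_maxl _ _) Nm).
have {}h2 := h2 (maxn N1 N2) m (leq_maxr _ _) (leq_trans (leq_maxr _ _) Nm).
have sq0 (xi : nat -> H) n : 0 <= \sum_(n <= k < m) `|xi k| ^+ 2.
  by apply: sumr_ge0 => k _; rewrite exprn_ge0.
rewrite (ger0_norm (sq0 _ _)) in h1; rewrite (ger0_norm (sq0 _ _)) in h2.
rewrite (le_trans (ler_norm_sum _ _ _))// (splitr d).
rewrite (le_trans _ (ler_wpM2l c0 (lerD h1 h2)))// -big_split/= mulr_sumr ler_sum//.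
move=> k _; rewrite (le_trans (cauchy_schwarz _ _))//.
rewrite (le_trans (ler_wpM2r (normr_ge0 _) (Tc _)))// -mulrA ler_wpM2l//.
set a := `|p.1 k|; set b := `|p.2 k|.
have ab : 0 <= (a - b) ^+ 2 by rewrite real_exprn_even_ge0// rpredB// normr_real.
rewrite -subr_ge0 (_ : _ - _ = (a - b) ^+ 2 + a * b); last by ring.
by rewrite addr_ge0// mulr_ge0 ?normr_ge0.
Qed.

Lemma pairing_approx (d : C) : 0 < d -> exists N, forall (T : bop H) c, 0 <= c ->
  bounded_by T c ->
  `|ultraweak_pairing p T - \sum_(0 <= k < N) dot (T (p.1 k)) (p.2 k)| <= c * d.
Proof.
move=> d0; have [N NP] := pairing_tail d0; exists N => T c c0 Tc.
set u := fun n => dot (T (p.1 n)) (p.2 n) : C^o.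
have u_cvg : cvg (series u @ \oo).
  apply: complex_cauchy_cvg => e e0; have c1 : 0 < c + 1 by rewrite ltr_wpDl.
  have [M MP] := pairing_tail (divr_gt0 e0 c1); exists M => m Mm.
  rewrite sub_series_geq// (le_trans (MP T c m c0 Tc Mm))//.
  by rewrite mulrCA ler_piMr ?(ltW e0)// ler_pdivrMr// mul1r lerDl.
apply/ler_addgt0Pr => e e0.
have /cvgrPdist_le/(_ e e0)[M _ /(_ (maxn M N) (leq_maxl _ _)) uM] := u_cvg.
rewrite -[X in X - _]/(lim (series u @ \oo)) -(subrKA (series u (maxn M N))).
rewrite (le_trans (ler_normD _ _))// addrC lerD//.
by rewrite -[X in _ - X]/(series u N) sub_series_geq ?leq_maxr// NP ?leq_maxr.
Qed.

(** Both sides are within any [d] of the same finite sums, because the truncation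
    index of [pairing_approx] serves all operators at once. *)
Lemma pairing_linear (c : C) (S T : bop H) :
  ultraweak_pairing p (c *: S + T) = c * ultraweak_pairing p S + ultraweak_pairing p T.
Proof.
have [[a a0 Sa] [b b0 Tb]] := (bop_bound S, bop_bound T).
apply/eqP; rewrite -subr_eq0; apply/eqP.
apply: (@small_norm_eq0 _ C^o ((`|c| * a + b) + (`|c| * a + b))) => d d0.
have [N NP] := pairing_approx d0.
pose sum (T : bop H) : C := \sum_(0 <= k < N) dot (T (p.1 k)) (p.2 k).
have sum_lin : sum (c *: S + T) = c * sum S + sum T.
  rewrite /sum mulr_sumr -big_split; apply: eq_bigr => k _.
  by rewrite bopDE bopZE dotDl dotZl.
have hS := NP S a (ltW a0) Sa; have hT := NP T b (ltW b0) Tb.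
have cab : 0 <= `|c| * a + b by rewrite addr_ge0 ?mulr_ge0// ltW.
have hST := NP _ _ cab (bounded_byD (bounded_byZ c Sa) Tb).
rewrite -/(sum _) in hS hT hST.
rewrite -(subrKA (sum (c *: S + T))) {2}sum_lin (le_trans (ler_normD _ _))//.
rewrite [leRHS]mulrDl lerD// opprD addrACA -mulrBr mulrDl.
rewrite (le_trans (ler_normD _ _))// lerD//; last by rewrite distrC.
by rewrite normrM -mulrA ler_wpM2l// distrC.
Qed.

End ultraweak.

(** * The von Neumann algebra of the product state *)

Section gns_space.
Local Open Scope sesquilinear_scope.
Context {R : realType}.
Local Notation C := R[i].
Local Notation incl := Defs.incl.
Variable alpha : R.
Hypotheses (alpha_gt0 : 0 < alpha) (alpha_lt1 : alpha < 1).
Context {A : cstarType R} {H : hilbertType R}.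
Variables (f : forall n, 'M[C]_(2 ^ n.+1) -> A) (rho : A -> C).
Arguments f : clear implicits.
Variables (pi : A -> bop H) (Omega : H).
Hypothesis limA : inductive_limit f.
Hypothesis rho_level : forall n x, rho (f n x) = level_state alpha x.
Hypothesis state_rho : state rho.
Hypothesis gns_pi : gns rho pi Omega.

Local Notation tau := (level_state alpha).

Definition mxop n (x : 'M[C]_(2 ^ n.+1)) : bop H := pi (f n x).
Definition gns_vec n (x : 'M[C]_(2 ^ n.+1)) : H := mxop x Omega.

Let pi_rep : star_representation pi. Proof. by case: gns_pi. Qed.

Lemma mxop_linear n : linear (@mxop n).
Proof.
have [fn _ _ _] := limA; have [f_lin _ _ _] := fn n.
by have [pi_lin _ _ _] := pi_rep; move=> c x y; rewrite /mxop f_lin pi_lin.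
Qed.

Lemma mxopM n (x y : 'M[C]_(2 ^ n.+1)) u : mxop (x *m y) u = mxop x (mxop y u).
Proof.
have [fn _ _ _] := limA; have [_ fM _ _] := fn n.
by have [_ piM _ _] := pi_rep; rewrite /mxop fM piM.
Qed.

Lemma mxop1 n : mxop (1%:M : 'M[C]_(2 ^ n.+1)) = bop_id.
Proof.
have [fn _ _ _] := limA; have [_ _ f1 _] := fn n.
by have [_ _ pi1 _] := pi_rep; rewrite /mxop f1 pi1.
Qed.

Lemma mxop_adj n (x : 'M[C]_(2 ^ n.+1)) u v : dot (mxop x u) v = dot u (mxop (x ^t*) v).
Proof.
have [fn _ _ _] := limA; have [_ _ _ f_adj] := fn n.
by have [_ _ _ pi_adj] := pi_rep; rewrite /mxop f_adj pi_adj.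
Qed.

Lemma mxop_incl n (x : 'M[C]_(2 ^ n.+1)) : mxop (incl x) = mxop x.
Proof. by have [_ _ f_incl _] := limA; rewrite /mxop f_incl. Qed.

Lemma gns_vec_linear n : linear (@gns_vec n).
Proof. by move=> c x y; rewrite /gns_vec mxop_linear. Qed.

Lemma mxop_vec n (x y : 'M[C]_(2 ^ n.+1)) : mxop x (gns_vec y) = gns_vec (x *m y).
Proof. by rewrite /gns_vec mxopM. Qed.

Lemma dot_mxop n (x : 'M[C]_(2 ^ n.+1)) : dot (mxop x Omega) Omega = tau x.
Proof. by have [_ _ pi_rho] := gns_pi; rewrite pi_rho rho_level. Qed.

Lemma dot_gns_vec n (x y : 'M[C]_(2 ^ n.+1)) :
  dot (gns_vec x) (gns_vec y) = tau (y ^t* *m x).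
Proof. by rewrite {2}/gns_vec -[y in mxop y]adjmxK -mxop_adj mxop_vec dot_mxop. Qed.

Lemma norm_gns_vec n (x : 'M[C]_(2 ^ n.+1)) : `|gns_vec x| ^+ 2 = tau (x ^t* *m x).
Proof. by rewrite -dot_norm dot_gns_vec. Qed.

(** Any matrix can be moved to a higher level without changing the operator, its
    KMS adjoint, or its multiplication bounds.  Stating this existentially avoids
    casts between the matrix types of different levels. *)
Lemma lift_level n N (b : 'M[C]_(2 ^ n.+1)) : (n <= N)%N ->
  exists b' : 'M[C]_(2 ^ N.+1),
    [/\ mxop b' = mxop b, mxop (kms_adj alpha b') = mxop (kms_adj alpha b),
        forall K, rmul_bounded alpha b K -> rmul_bounded alpha b' K &
        forall K, lmul_bounded alpha b K -> lmul_bounded alpha b' K].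
Proof.
elim: N => [|N IH]; first by rewrite leqn0 => /eqP n0; subst n; exists b.
rewrite leq_eqVlt => /orP[/eqP nN|/IH[b' [e1 e2 r l]]]; first by subst n; exists b.
exists (incl b'); split.
- by rewrite mxop_incl.
- by rewrite (kms_adj_incl alpha_gt0 alpha_lt1) mxop_incl.
- by move=> K /r; exact: (rmul_bounded_incl alpha_gt0 alpha_lt1).
- by move=> K /l; exact: (lmul_bounded_incl alpha_gt0 alpha_lt1).
Qed.

(** Matrices are dense in the C*-algebra, which acts continuously, and [Omega] is
    cyclic. *)
Lemma gns_vec_dense n u (e : C) : 0 < e ->
  exists N (x : 'M[C]_(2 ^ N.+1)), (n <= N)%N /\ `|u - gns_vec x| < e.
Proof.
move=> e0; have [_ cyc _] := gns_pi; have [_ _ _ fdense] := limA.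
have e2 : 0 < e / 2 by rewrite divr_gt0.
have [_ [a _ <-] ua] := closure_approx u cyc e2.
pose k := 2 * (`|Omega| + 1).
have k0 : 0 < k by rewrite mulr_gt0// ltr_wpDl.
have : closure (\bigcup_n range (f n)) a by rewrite fdense.
move=> /(_ _ (nbhsx_ballx a (e / 2 / k) (divr_gt0 e2 k0)))[b [[m _ [x _ <-]]]].
rewrite -ball_normE /= => ax.
have [x' [x'E _ _ _]] := lift_level x (leq_maxl m n).
exists (maxn m n), x'; split; first exact: leq_maxr.
rewrite /gns_vec x'E -(subrKA (pi a Omega)) (le_lt_trans (ler_normD _ _))// (splitr e).
rewrite ltr_leD//; have [pi_lin _ _ _] := pi_rep.
rewrite -bopBE.
rewrite -(linB (s := GRing.scale) pi_lin).
rewrite (le_trans (star_representation_bound pi_rep _ _))//.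
rewrite ltr_pdivlMr// in ax; rewrite (le_trans _ (ltW ax))// /k.
by rewrite mulrAC mulrC ler_wpM2l// ler_wpM2l// lerDl.
Qed.

Lemma gns_vec_approx n u (e : C) : 0 < e ->
  exists2 v, (exists N (x : 'M[C]_(2 ^ N.+1)), (n <= N)%N /\ v = gns_vec x) &
    `|u - v| < e.
Proof.
by move=> /(gns_vec_dense n u)[N [x [nN ux]]]; exists (gns_vec x) => //; exists N, x.
Qed.

(** Since [pi] is continuous, commuting with the matrix algebras is enough. *)
Lemma commutant_range (T : bop H) :
  (forall n x u, T (@mxop n x u) = mxop x (T u)) -> commutant (range pi) T.
Proof.
move=> Tx _ [a _ <-]; apply: bop_eqP => u /=.
have [_ _ _ fdense] := limA; have [pi_lin _ _ _] := pi_rep.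
have [c c0 Tc] := bop_bound T.
apply/eqP; rewrite -subr_eq0; apply/eqP.
apply: (@small_norm_eq0 _ _ (c * (2 * `|u|) + 2 * `|T u|)) => e e0.
have [_ [n _ [x _ <-]] ax] := closure_approx a fdense e0.
have -> : T (pi a u) - pi a (T u) = T (pi (a - f n x) u) - pi (a - f n x) (T u).
  rewrite (linB (s := GRing.scale) pi_lin).
  by rewrite !bopBE (linB (bop_lin T)) -/(mxop x) Tx opprB addrA subrK.
have le v : `|pi (a - f n x) v| <= 2 * `|v| * e.
  rewrite (le_trans (star_representation_bound pi_rep _ _))// mulrAC.
  by rewrite ler_wpM2l ?mulr_ge0// ltW.
rewrite (le_trans (ler_normB _ _))// mulrDl lerD//.
by rewrite (le_trans (Tc _))// -mulrA ler_wpM2l// ltW.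
Qed.

(** Multiplying by a matrix unit moves column [i] to column [j], which changes its
    contribution to the norm by the ratio of the weights. *)
Let rmul_bounded_delta n i j :
  rmul_bounded alpha (delta_mx i j : 'M[C]_(2 ^ n.+1)) (weight alpha j / weight alpha i).
Proof.
move=> a; rewrite !level_state_sq// (bigD1 j)//= [X in _ + X <= _]big1 ?addr0 => [|l lj].
  rewrite [in leRHS](bigD1 i)//= mulrDr ler_wpDr//.
    rewrite mulr_ge0 ?divr_ge0 ?weight_ge0// sumr_ge0// => l _.
    by rewrite sumr_ge0// => k _; rewrite mulr_ge0 ?exprn_ge0 ?weight_ge0.
  rewrite mulr_sumr ler_sum// => k _; rewrite mulrCA divfK ?weight_neq0//.
  rewrite mxE (bigD1 i)//= big1 ?addr0 => [|m mi].
    by rewrite mxE !eqxx mulr1.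
  by rewrite mxE (negPf mi) mulr0.
rewrite big1// => k _; rewrite mxE big1 ?normr0 ?expr0n ?mul0r// => m _.
by rewrite mxE (negPf lj) andbF mulr0.
Qed.

Let rmul_norm n (b : 'M[C]_(2 ^ n.+1)) K : 0 <= K -> rmul_bounded alpha b K ->
  forall a, `|gns_vec (a *m b)| <= (K + 1) * `|gns_vec a|.
Proof.
move=> K0 bK a; have K1 : 0 <= K + 1 by rewrite addr_ge0.
rewrite -(@ler_pXn2r _ 2)// ?nnegrE ?mulr_ge0// exprMn !norm_gns_vec.
rewrite (le_trans (bK a))// -norm_gns_vec ler_wpM2r ?exprn_ge0//.
by rewrite (@le_trans _ _ (K + 1)) ?lerDl// ler_eXnr// lerDr.
Qed.

Lemma rmul_boundedP n (b : 'M[C]_(2 ^ n.+1)) :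
  exists2 K, 0 <= K & rmul_bounded alpha b K.
Proof.
pose k i j : C := `|b i j| * (weight alpha j / weight alpha i + 1).
have w0 i j : 0 <= @weight _ alpha n j / @weight _ alpha n i.
  by rewrite divr_ge0 ?weight_ge0.
have k0 i j : 0 <= k i j by rewrite mulr_ge0 ?addr_ge0.
exists ((\sum_i \sum_j k i j) ^+ 2).
  by rewrite exprn_ge0// sumr_ge0// => i _; rewrite sumr_ge0.
move=> a; rewrite -!norm_gns_vec -exprMn ler_pXn2r ?nnegrE//; last first.
  by rewrite mulr_ge0// sumr_ge0// => i _; rewrite sumr_ge0.
rewrite [in leLHS](matrix_sum_delta b) mulmx_sumr (lin_sum (@gns_vec_linear n)).
rewrite (le_trans (ler_norm_sum _ _ _))// mulr_suml ler_sum// => i _.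
rewrite mulmx_sumr (lin_sum (@gns_vec_linear n)).
rewrite (le_trans (ler_norm_sum _ _ _))// mulr_suml ler_sum// => j _.
rewrite -scalemxAr (linZ (s := GRing.scale) (@gns_vec_linear n)) normrZ /k -mulrA.
by rewrite ler_wpM2l// rmul_norm//; exact: rmul_bounded_delta.
Qed.

(** On the vectors [a Omega], right multiplication by [b] commutes with the left
    multiplications [mxop]; its bound at level [n] is a bound at all higher levels,
    so it extends to the whole space. *)
Lemma right_mul n (b : 'M[C]_(2 ^ n.+1)) : exists T : bop H,
  commutant (range pi) T /\
  forall N (a : 'M[C]_(2 ^ N.+1)), T (gns_vec a) = mxop a (gns_vec b).
Proof.
have [K K0 bK] := rmul_boundedP b.
pose Gr u v := exists N (a : 'M[C]_(2 ^ N.+1)),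
  [/\ (n <= N)%N, u = gns_vec a & v = mxop a (gns_vec b)].
have lift2 N (a : 'M[C]_(2 ^ N.+1)) M : (N <= M)%N ->
    exists a' : 'M[C]_(2 ^ M.+1), mxop a' = mxop a.
  by move=> /(lift_level a)[a' [? _ _ _]]; exists a'.
have [T TP] : exists T : bop H, forall u v, Gr u v -> T u = v.
  apply: (@bounded_extension _ _ Gr (K + 1)); first by rewrite addr_ge0.
  - move=> c _ _ _ _ [N [a [nN -> ->]]] [N' [a' [nN' -> ->]]].
    have [x xE] := lift2 _ a _ (leq_maxl N N').
    have [x' xE'] := lift2 _ a' _ (leq_maxr N N').
    exists (maxn N N'), (c *: x + x'); split.
    + by rewrite leq_max nN.
    + by rewrite gns_vec_linear /gns_vec xE xE'.
    + by rewrite mxop_linear -xE -xE'.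
  - move=> _ _ [N [a [nN -> ->]]].
    have [b' [b'E _ b'K _]] := lift_level b nN.
    rewrite {1}/gns_vec -b'E -/(gns_vec b') mxop_vec.
    by apply: rmul_norm => //; exact: b'K.
  - move=> u e /(gns_vec_dense n u)[N [a [nN ua]]].
    by exists (gns_vec a), (mxop a (gns_vec b)); split=> //; exists N, a.
have Tvec N (a : 'M[C]_(2 ^ N.+1)) : T (gns_vec a) = mxop a (gns_vec b).
  have [a' a'E] := lift2 _ a _ (leq_maxl N n).
  rewrite /gns_vec -a'E -/(gns_vec a'); apply: TP; exists (maxn N n), a'.
  by split=> //; exact: leq_maxr.
exists T; split=> //; apply: commutant_range => m x u.
suff e : bop_comp T (mxop x) = bop_comp (mxop x) T.
  by have := congr1 (fun S : bop H => S u) e.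
apply: (bop_eq_dense (gns_vec_approx m)) => _ [N [a [mN ->]]] /=.
have [x' x'E] := lift2 _ x _ mN.
by rewrite -x'E mxop_vec !Tvec mxopM.
Qed.

Lemma right_mul_adj n (b : 'M[C]_(2 ^ n.+1)) : exists T T' : bop H,
  [/\ commutant (range pi) T, commutant (range pi) T',
      forall u v, dot (T u) v = dot u (T' v),
      forall a : 'M[C]_(2 ^ n.+1), T (gns_vec a) = gns_vec (a *m b) &
      forall a : 'M[C]_(2 ^ n.+1), T' (gns_vec a) = gns_vec (a *m kms_adj alpha b)].
Proof.
have [T [Tc TP]] := right_mul b; have [T' [Tc' TP']] := right_mul (kms_adj alpha b).
exists T, T'; split=> //; try by move=> a; rewrite ?TP ?TP' mxop_vec.
apply: (adjoint_dense (gns_vec_approx n)) => _ _ [N [a [nN ->]]] [N' [c [nN' ->]]].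
have [a' [a'E _ _ _]] := lift_level a (leq_maxl N N').
have [c' [c'E _ _ _]] := lift_level c (leq_maxr N N').
have [b' [b'E kb'E _ _]] := lift_level b (leq_trans nN (leq_maxl N N')).
rewrite TP TP' /gns_vec -a'E -c'E -b'E -kb'E -/(gns_vec c') -/(gns_vec b') -/(gns_vec a').
rewrite -/(gns_vec (kms_adj alpha b')) !mxop_vec !dot_gns_vec.
have -> : (c' *m kms_adj alpha b') ^t* *m a' = (a' ^t* *m c' *m kms_adj alpha b') ^t*.
  by rewrite !adjmxM adjmxK mulmxA.
by rewrite level_state_conj// kms_adjP// -level_state_conj// !adjmxM !adjmxK mulmxA.
Qed.

Local Notation VN := (vnalg (range pi)).
Local Notation phi := (vector_state Omega : VN -> C).

Definition vn_mx n (x : 'M[C]_(2 ^ n.+1)) : VN := to_vnalg pi (f n x).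

Definition side_vn_mul (s : bool) (x y : VN) : VN := if s then vn_mul x y else vn_mul y x.

Lemma vn_mx_linear n : linear (@vn_mx n).
Proof. by move=> c x y; apply: val_inj; exact: mxop_linear. Qed.

Lemma vn_comm (y : VN) T u : commutant (range pi) T -> y (T u) = T (y u).
Proof.
move=> Tc; have /asboolP/(_ T Tc) e := valP y.
by have := congr1 (fun S : bop H => S u) e.
Qed.

Lemma side_vn_mul_linearr s (x : VN) : linear (side_vn_mul s x).
Proof.
move=> c y z; apply/val_inj/bop_eqP => u; rewrite /side_vn_mul; case: s => //.
by rewrite /= -[LHS]/(x (c *: y u + z u)) bop_lin.
Qed.

Lemma vector_state_scalar : scalar phi.
Proof. by move=> c x y; rewrite /vector_state /= dotDl dotZl. Qed.

Lemma gns_vec1 n : gns_vec (1%:M : 'M[C]_(2 ^ n.+1)) = Omega.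
Proof. by rewrite /gns_vec mxop1. Qed.

(** Write one of the two vectors as the image of [Omega] under a right multiplication,
    let its adjoint pass through [y], which it commutes with, and absorb it in the
    other vector.  Which of the two is moved decides the side on which the matrix [c]
    appears. *)
Lemma kms_transfer s n (a b : 'M[C]_(2 ^ n.+1)) : exists c : 'M[C]_(2 ^ n.+1),
  forall y : VN, dot (y (gns_vec a)) (gns_vec b) = phi (side_vn_mul s y (vn_mx c)).
Proof.
case: s.
  have [T [T' [_ Tc' adjT Tv Tv']]] := right_mul_adj b.
  exists (a *m kms_adj alpha b) => y.
  have -> : gns_vec b = T Omega by rewrite -(gns_vec1 n) Tv mul1mx.
  rewrite dotC adjT -dotC -(vn_comm _ _ Tc') Tv'.
  by [].
have [T [T' [Tc _ adjT Tv Tv']]] := right_mul_adj a.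
exists ((b *m kms_adj alpha a) ^t*) => y.
have -> : gns_vec a = T Omega by rewrite -(gns_vec1 n) Tv mul1mx.
rewrite (vn_comm _ _ Tc) adjT Tv' -[in LHS](adjmxK (b *m _)).
by rewrite {1}/gns_vec -mxop_adj.
Qed.

(** By [kms_transfer] all matrix coefficients of [x] vanish. *)
Lemma vn_separating s (x : VN) :
  (forall n (c : 'M[C]_(2 ^ n.+1)), phi (side_vn_mul s x (vn_mx c)) = 0) -> x = 0.
Proof.
move=> x0; apply/val_inj/(bop_eq_dense (gns_vec_approx 0)) => _ [n [a [_ ->]]].
apply: (orthogonal_dense0 (gns_vec_approx n)) => _ [m [b [nm ->]]].
have [a' [a'E _ _ _]] := lift_level a nm.
have [c xc] := kms_transfer s a' b.
by rewrite /gns_vec -a'E -/(gns_vec a') xc x0.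
Qed.

Lemma bounded_by_dense n (T : bop H) k : 0 <= k ->
  (forall N (a : 'M[C]_(2 ^ N.+1)), (n <= N)%N -> `|T (gns_vec a)| <= k * `|gns_vec a|) ->
  bounded_by T k.
Proof.
move=> k0 Ta u; have [c c0 Tc] := bop_bound T.
apply/ler_addgt0Pr => e e0.
have ck : 0 < c + k by rewrite ltr_wpDr.
have [_ [N [a [nN ->]]] ua] := gns_vec_approx n u (divr_gt0 e0 ck).
rewrite -(subrK (gns_vec a) u) (linD (bop_lin T)) (le_trans (ler_normD _ _))//.
rewrite subrK addrC.
have -> : k * `|u| + e = k * (`|u| + e / (c + k)) + c * (e / (c + k)).
  by field; rewrite gt_eqF.
rewrite lerD//; last by rewrite (le_trans (Tc _))// ler_wpM2l ?ltW.
rewrite (le_trans (Ta _ _ nN))// ler_wpM2l// -(subrK u (gns_vec a)).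
by rewrite (le_trans (ler_normD _ _))// addrC lerD2l distrC ltW.
Qed.

(** The matrix [c] is the conditional expectation of [y]: its action on the vectors
    of level [n] is the compression of [y] to their span, so it has no larger norm
    there.  The bound then holds on all higher levels, hence everywhere. *)
Lemma cond_exp n (y : VN) : exists c : 'M[C]_(2 ^ n.+1),
  (forall s (x : 'M[C]_(2 ^ n.+1)),
    phi (side_vn_mul s y (vn_mx x)) = tau (side_mulmx s c x)) /\
  forall k, 0 <= k -> bounded_by y k -> bounded_by (mxop c) k.
Proof.
have L_lin : scalar (fun x : 'M[C]_(2 ^ n.+1) => phi (side_vn_mul true y (vn_mx x))).
  by move=> c x z; rewrite vn_mx_linear side_vn_mul_linearr vector_state_scalar.
have [c cP] := level_state_riesz alpha_gt0 alpha_lt1 L_lin.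
have cE (a b : 'M[C]_(2 ^ n.+1)) :
    dot (y (gns_vec a)) (gns_vec b) = dot (gns_vec (c *m a)) (gns_vec b).
  have [x xP] := kms_transfer true a b.
  rewrite xP cP -mxop_vec -[mxop c _]/(vn_mx c (gns_vec a)) xP.
  by rewrite -dot_mxop mxopM.
exists c; split=> [[] x|k k0 yk].
- exact: cP.
- rewrite /side_mulmx -[LHS]/(dot (mxop x (y Omega)) Omega).
  rewrite mxop_adj -{1}(gns_vec1 n) cE mulmx1.
  by rewrite dot_gns_vec adjmxK.
have ck : lmul_bounded alpha c (k ^+ 2).
  move=> a; rewrite -!norm_gns_vec -exprMn ler_pXn2r ?nnegrE ?mulr_ge0//.
  have [->|ca0] := eqVneq (gns_vec (c *m a)) 0; first by rewrite normr0 mulr_ge0.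
  have nca : 0 < `|gns_vec (c *m a)| by rewrite normr_gt0.
  rewrite -(ler_pM2r nca) -expr2 -dot_norm -cE -[dot _ _]ger0_norm; last first.
    by rewrite cE dot_norm exprn_ge0.
  by rewrite (le_trans (cauchy_schwarz _ _))// ler_wpM2r.
apply: (bounded_by_dense (n := n)) => // N a nN.
have [c' [c'E _ _ c'k]] := lift_level c nN.
rewrite -c'E mxop_vec -(@ler_pXn2r _ 2)// ?nnegrE ?mulr_ge0// exprMn !norm_gns_vec.
exact: c'k.
Qed.

Lemma norm_Omega : `|Omega| = 1.
Proof.
have [_ _ piE] := gns_pi; have [_ _ pi1 _] := pi_rep; have [_ _ rho1] := state_rho.
have := piE cone; rewrite pi1 rho1 /= dot_norm => /eqP.
by rewrite sqrp_eq1// => /eqP.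
Qed.

(** The hypothesis says that [x^* x] is a projection. *)
Lemma mxop_partial_isometry n (x : 'M[C]_(2 ^ n.+1)) :
  (x ^t* *m x) ^t* *m (x ^t* *m x) = x ^t* *m x -> bounded_by (mxop x) 1.
Proof.
move=> xP u; rewrite mul1r; pose P := x ^t* *m x.
have Pu : `|mxop P u| ^+ 2 = `|mxop x u| ^+ 2.
  by rewrite -!dot_norm mxop_adj -mxopM /P xP mxopM -mxop_adj.
have -> : `|mxop x u| = `|mxop P u|.
  by apply/eqP; rewrite -(@eqrXn2 _ 2)// Pu.
have [->|Pu0] := eqVneq (mxop P u) 0; first by rewrite normr0.
have nP : 0 < `|mxop P u| by rewrite normr_gt0.
have e : `|mxop x u| ^+ 2 = dot (mxop P u) u.
  by rewrite -dot_norm /P mxopM [in RHS]mxop_adj adjmxK.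
rewrite -(ler_pM2l nP) -expr2 Pu -[leLHS]ger0_norm ?exprn_ge0// e.
exact: cauchy_schwarz.
Qed.

(** Independence of the level is the point: each matrix unit of the last factor is a
    partial isometry. *)
Lemma kron1_bounded (y : 'M[C]_2) : exists2 k : C, 0 <= k &
  forall n, bounded_by (mxop (kron (1%:M : 'M[C]_(2 ^ n.+1)) y)) k.
Proof.
exists (\sum_p \sum_q `|y p q|) => [|n].
  by rewrite sumr_ge0// => p _; rewrite sumr_ge0.
rewrite {1}(matrix_sum_delta y) (lin_sum (kron_linearr _)) (lin_sum (@mxop_linear _)).
apply: bounded_by_sum => p _.
rewrite (lin_sum (kron_linearr _)) (lin_sum (@mxop_linear _)).
apply: bounded_by_sum => q _.
rewrite (linZ (s := GRing.scale) (kron_linearr _)).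
rewrite (linZ (s := GRing.scale) (@mxop_linear _)) -[`|y p q|]mulr1.
apply/bounded_byZ/mxop_partial_isometry.
have adj1 : (1%:M : 'M[C]_(2 ^ n.+1)) ^t* = 1%:M.
  by apply/matrixP => i j; rewrite !mxE eq_sym rmorph_nat.
by rewrite !(kron_adj, kron_mul, adj1, mulmx1, adj_delta, mul_delta_mx).
Qed.

Definition shell_trunc n K (z : 'M[C]_(2 ^ n.+1)) : 'M[C]_(2 ^ n.+1) :=
  \matrix_(b, a) (z b a *+ (shell0 a b < K)%N).

(** Cutting out a rectangle of entries is multiplication by diagonal projections on
    both sides. *)
Lemma shell_trunc_bounded n K (z : 'M[C]_(2 ^ n.+1)) k : 0 <= k ->
  bounded_by (mxop z) k -> bounded_by (mxop (shell_trunc K z)) (3 * k).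
Proof.
move=> k0 zk; have [P [Q PQ]] := shell0_initial K.
pose D (p : pred nat) : 'M[C]_(2 ^ n.+1) := \matrix_(i, j) ((p i && (i == j))%:R).
have Dl p x i j : (D p *m x) i j = x i j *+ (p i).
  rewrite mxE (bigD1 i)//= big1 ?addr0 => [|l li].
    by rewrite mxE eqxx andbT mulr_natl.
  by rewrite mxE eq_sym (negPf li) andbF mul0r.
have Dr p x i j : (x *m D p) i j = x i j *+ (p j).
  rewrite mxE (bigD1 j)//= big1 ?addr0 => [|l lj].
    by rewrite mxE eqxx andbT mulr_natr.
  by rewrite mxE (negPf lj) andbF mulr0.
have Dadj p : (D p) ^t* = D p.
  apply/matrixP => i j; rewrite !mxE rmorph_nat eq_sym; congr (nat_of_bool _)%:R.
  by case: eqP => [->|]; rewrite ?andbF.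
have DD p : D p *m D p = D p.
  by apply/matrixP => i j; rewrite Dl mxE; case: (p i).
have Dk p : bounded_by (mxop (D p)) 1.
  by apply: mxop_partial_isometry; rewrite Dadj DD Dadj DD.
have -> : shell_trunc K z = \sum_(i < 3) D (P i) *m z *m D (Q i).
  apply/matrixP => b a; rewrite summxE mxE PQ -sumrMnr.
  apply: eq_bigr => i _; rewrite Dr Dl -mulrnA mulnb.
  by case: (P i b).
rewrite (lin_sum (@mxop_linear _)).
apply: (bounded_byW (k := (\sum_(i < 3) k))).
  by rewrite sumr_const card_ord mulr_natl.
apply: bounded_by_sum => i _.
have -> : mxop (D (P i) *m z *m D (Q i)) =
    bop_comp (mxop (D (P i))) (bop_comp (mxop z) (mxop (D (Q i)))).
  by apply: bop_eqP => u; rewrite !mxopM.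
rewrite -[k]mul1r; apply: bounded_by_comp => //.
by rewrite -[k]mulr1; apply: bounded_by_comp.
Qed.

Lemma mxop_kron n (x : 'M[C]_(2 ^ n.+1)) (y : 'M[C]_2) :
  mxop (kron x y) = bop_comp (mxop x) (mxop (kron (1%:M : 'M[C]_(2 ^ n.+1)) y)).
Proof.
apply: bop_eqP => u; rewrite /= -[mxop x]mxop_incl -mxopM /Defs.incl kron_mul.
by rewrite mulmx1 mul1mx.
Qed.

Lemma side_vn_mul_bounded s (x y : VN) k l : 0 <= k -> 0 <= l ->
  bounded_by x k -> bounded_by y l -> bounded_by (side_vn_mul s x y) (k * l).
Proof.
by rewrite /side_vn_mul; case: s => k0 l0 xk yl; [|rewrite mulrC]; apply: bounded_by_comp.
Qed.

Lemma vector_state_bounded (x : VN) k : bounded_by x k -> `|phi x| <= k.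
Proof.
move=> xk; rewrite (le_trans (cauchy_schwarz _ _))//.
by have := xk Omega; rewrite norm_Omega !mulr1.
Qed.

Section haar_partial_sums.
Variables (s : bool) (r : 'I_4 -> 'M[C]_2).
Hypothesis r0 : r ord0 = 1%:M.
Hypothesis r_orth : forall p q, @side_form R alpha s 0 (r p) (r q) = (p == q)%:R.

Local Notation haar_sqnorm := (haar_sqnorm alpha s r).

(** The [j]-th term of the Haar expansion of [y] in the adjoint system.  The [j]-th
    coefficient of the expansion of a functional [psi] is dual to it: pairing the
    [j]-th term of that expansion with [y] gives the value of [psi] at [haar_term]. *)
Definition haar_term n (y : VN) j : VN :=
  ((haar_sqnorm n j)^-1 * phi (side_vn_mul s y (vn_mx (haar r n j)))) *:
  vn_mx ((haar r n j) ^t*).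

(** A Haar element is the same at all levels at which it occurs. *)
Lemma haar_term_level n j y : (j < 4 ^ n.+1)%N ->
  [/\ haar_seq pi f r j = vn_mx (haar r n j),
      haar_sqnorm j j = haar_sqnorm n j,
      vn_mx ((haar r j j) ^t*) = vn_mx ((haar r n j) ^t*) &
      haar_term j y j = haar_term n y j].
Proof.
pose t m := (vn_mx (haar r m j), haar_sqnorm m j, vn_mx ((haar r m j) ^t*)).
have tS m : (j < 4 ^ m.+1)%N -> t m.+1 = t m.
  move=> jm; have [hE nE] := haar_level r0 r_orth jm.
  rewrite /t nE hE incl_adj; congr (_, _, _); apply/val_inj; exact: mxop_incl.
have tadd k m : (j < 4 ^ m.+1)%N -> t (k + m)%N = t m.
  move=> jm; elim: k => [//|k IH]; rewrite addSn tS// (leq_trans jm)//.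
  by rewrite leq_exp2l// ltnS leq_addl.
move=> jn; have jj : (j < 4 ^ j.+1)%N by rewrite (ltn_trans (ltnSn j))// ltn_expl.
have tjn : t j = t n by rewrite -(tadd n j)// -(tadd j n)// addnC.
have e1 : vn_mx (haar r j j) = vn_mx (haar r n j) := congr1 (fun x => x.1.1) tjn.
have e2 : haar_sqnorm j j = haar_sqnorm n j := congr1 (fun x => x.1.2) tjn.
have e3 := congr1 snd tjn; rewrite /= in e3.
by split=> //; rewrite /haar_term e1 e2 e3.
Qed.

Lemma haar_term_bounded n j : exists2 c : C, 0 <= c & forall (y : VN) k,
  0 <= k -> bounded_by y k -> bounded_by (haar_term n y j) (c * k).
Proof.
have [c c0 hc] := bop_bound (vn_mx (haar r n j)).
have [d d0 hd] := bop_bound (vn_mx ((haar r n j) ^t*)).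
exists (`|(haar_sqnorm n j)^-1| * c * d) => [|y k k0 yk]; first by rewrite !mulr_ge0// ltW.
have yh : bounded_by (side_vn_mul s y (vn_mx (haar r n j))) (k * c).
  by apply: side_vn_mul_bounded => //; exact: ltW.
have := bounded_byZ ((haar_sqnorm n j)^-1 * phi (side_vn_mul s y (vn_mx (haar r n j)))) hd.
apply: bounded_byW; rewrite normrM [leRHS]mulrAC ler_wpM2r ?(ltW d0)//.
by rewrite -mulrA ler_wpM2l// mulrC vector_state_bounded.
Qed.

(** Within one quarter of a level, the terms are those of the matrix unit expansion of
    the conditional expectation of [y r_p] (or [r_p y]), tensored with [r_p^*]. *)
Lemma haar_block n (p : 'I_4) K (y : VN) : p != ord0 -> (K <= 4 ^ n.+1)%N ->
  exists c : 'M[C]_(2 ^ n.+1),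
    \sum_(0 <= k < K) haar_term n.+1 y (4 ^ n.+1 * p + k) =
      vn_mx (kron (shell_trunc K c) ((r p) ^t*)) /\
    forall k, 0 <= k ->
      bounded_by (side_vn_mul s y (vn_mx (kron (1%:M : 'M[C]_(2 ^ n.+1)) (r p)))) k ->
      bounded_by (mxop c) k.
Proof.
move=> p0 KN; set y' := side_vn_mul _ _ _.
have [c [cE cb]] := cond_exp n y'; exists c; split; last exact: cb.
have -> : kron (shell_trunc K c) ((r p) ^t*) = \sum_(0 <= k < K)
    ((side_form alpha s (matrix_unit n k) (matrix_unit n k))^-1 *
      tau (side_mulmx s c (matrix_unit n k))) *: kron ((matrix_unit n k) ^t*) ((r p) ^t*).
  rewrite /shell_trunc -(matrix_unit_partial_sum alpha_gt0 alpha_lt1 s)//.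
  rewrite (lin_sum (s := GRing.scale) (kron_linearl _)).
  by apply: eq_bigr => k _; rewrite (linZ (s := GRing.scale) (kron_linearl _)).
rewrite (lin_sum (s := GRing.scale) (@vn_mx_linear _)).
apply: eq_big_nat => k /andP[_ kK]; have kN := leq_trans kK KN.
rewrite (linZ (s := GRing.scale) (@vn_mx_linear _)) /haar_term.
rewrite (haar_sqnormS r_orth)// haarS// /haar_factor (negPf p0) kron_adj.
congr (_ * _ *: _); rewrite -cE; congr (vector_state _ _); apply/val_inj/bop_eqP => u.
rewrite /y' /side_vn_mul; case: (s).
  rewrite -[LHS]/(y (mxop (kron (matrix_unit n k) (r p)) u)).
  rewrite -[RHS]/(y (mxop (kron 1%:M (r p)) (mxop (matrix_unit n k) u))).
  by rewrite -[mxop (matrix_unit n k)]mxop_incl -mxopM /Defs.incl kron_mul mul1mx mulmx1.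
rewrite -[LHS]/(mxop (kron (matrix_unit n k) (r p)) (y u)).
by rewrite mxop_kron.
Qed.

Definition haar_partial_sum m (y : VN) : VN := \sum_(0 <= j < m) haar_term j y j.

Lemma haar_partial_sum_level n m y : (m <= 4 ^ n.+1)%N ->
  haar_partial_sum m y = \sum_(0 <= j < m) haar_term n y j.
Proof.
move=> mn; apply: eq_big_nat => j /andP[_ jm].
by have [_ _ _] := haar_term_level y (leq_trans jm mn).
Qed.

Lemma haar_block_bounded : exists2 c : C, 0 <= c &
  forall n (p : 'I_4) K (y : VN) k, p != ord0 -> (K <= 4 ^ n.+1)%N -> 0 <= k ->
    bounded_by y k ->
    bounded_by (\sum_(0 <= k < K) haar_term n.+1 y (4 ^ n.+1 * p + k)) (c * k).
Proof.
have /choice[a aP] (p : 'I_4) : exists a : C, 0 <= a /\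
    forall n, bounded_by (mxop (kron (1%:M : 'M[C]_(2 ^ n.+1)) (r p))) a.
  by have [a a0 ab] := kron1_bounded (r p); exists a.
have /choice[b bP] (p : 'I_4) : exists b : C, 0 <= b /\
    forall n, bounded_by (mxop (kron (1%:M : 'M[C]_(2 ^ n.+1)) ((r p) ^t*))) b.
  by have [b b0 bb] := kron1_bounded ((r p) ^t*); exists b.
have a0 p : 0 <= a p by case: (aP p).
have b0 p : 0 <= b p by case: (bP p).
exists (\sum_p 3 * a p * b p) => [|n p K y k p0 KN k0 yk].
  by apply: sumr_ge0 => p _; rewrite !mulr_ge0.
have [c [-> cb]] := haar_block y p0 KN.
have [_ /(_ n) ab] := aP p; have [_ /(_ n) bb] := bP p.
have ck : bounded_by (mxop c) (k * a p).
  by apply: cb; [exact: mulr_ge0|exact: side_vn_mul_bounded].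
have := bounded_by_comp (mulr_ge0 (ler0n _ 3) (mulr_ge0 k0 (a0 p)))
  (shell_trunc_bounded K (mulr_ge0 k0 (a0 p)) ck) bb.
rewrite -mxop_kron; apply: bounded_byW.
have -> : 3 * (k * a p) * b p = 3 * a p * b p * k by ring.
rewrite ler_wpM2r// (bigD1 p)//= lerDl sumr_ge0// => q _.
by rewrite !mulr_ge0.
Qed.

(** From index 4 on, a partial sum consists of the terms of one full level, which
    add up to a conditional expectation, and of at most three blocks of the next
    level. *)
Lemma haar_partial_sum_bounded : exists2 c : C, 0 <= c &
  forall m (y : VN) k, 0 <= k -> bounded_by y k ->
    bounded_by (haar_partial_sum m y) (c * k).
Proof.
have [d d0 block] := haar_block_bounded.
have /choice[a aP] j : exists a : C, 0 <= a /\ forall (y : VN) k,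
    0 <= k -> bounded_by y k -> bounded_by (haar_term 0 y j) (a * k).
  by have [a a0 ab] := haar_term_bounded 0 j; exists a.
have a0 j : 0 <= a j by case: (aP j).
(* the first summand takes care of level 0, where each term is bounded by itself *)
pose c := \sum_(0 <= j < 4) a j + (1 + 3 * d).
have s0 : 0 <= \sum_(0 <= j < 4) a j by apply: sumr_ge0.
have d3 : 0 <= 1 + 3 * d by rewrite addr_ge0 ?mulr_ge0.
exists c => [|m y k k0 yk]; first exact: addr_ge0.
suff h : forall n m, (m < 4 ^ n.+1)%N -> bounded_by (haar_partial_sum m y) (c * k).
  by apply: (h m); rewrite (ltn_trans (ltnSn m))// ltn_expl.
elim=> [|n IH] {}m mn.
  rewrite (haar_partial_sum_level (n := 0)) ?(ltnW mn)//.
  apply: (bounded_byW (k := (\sum_(0 <= j < m) a j * k))).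
    rewrite -mulr_suml ler_wpM2r// -[leLHS]addr0 lerD//.
    rewrite [leRHS](big_cat_nat (n := m))//= ?(ltnW mn)// lerDl.
    by apply: sumr_ge0.
  rewrite -[vn_op _]/(\val _) raddf_sum; apply: bounded_by_sum => j _.
  by have [_] := aP j; apply.
have [q [K [KN mE]]] := haar_index mn; subst m.
have [q0|q0] := eqVneq q ord0; first by rewrite q0 muln0 add0n; exact: IH.
rewrite (haar_partial_sum_level (n := n.+1)) ?(ltnW mn)//.
rewrite big_nat_add big_nat_blocks big_ltn ?lt0n//.
have [e [eE eb]] := cond_exp n y.
have eE' : \sum_(0 <= k < 4 ^ n.+1) haar_term n.+1 y (4 ^ n.+1 * 0 + k) = vn_mx e.
  rewrite -(haar_complete alpha_gt0 alpha_lt1 r_orth e).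
  rewrite (lin_sum (s := GRing.scale) (@vn_mx_linear _)).
  apply: eq_big_nat => j /andP[_ jn].
  have jn' : (j < 4 ^ n.+2)%N by rewrite (leq_trans jn)// leq_exp2l.
  have [_ _ _ e1] := haar_term_level y jn'; have [_ _ _ e2] := haar_term_level y jn.
  rewrite muln0 add0n -e1 e2 /haar_term.
  by rewrite (linZ (s := GRing.scale) (@vn_mx_linear _)) -eE.
have q3 : (q <= 3)%N by rewrite -ltnS.
apply: (bounded_byW (k := ((k + \sum_(1 <= p < q) d * k) + d * k))).
  rewrite /c mulrDl -[leLHS]add0r lerD ?mulr_ge0// mulrDl mul1r -addrA lerD2l.
  rewrite sumr_const_nat -mulrSr subn1 prednK ?lt0n// -mulrA mulr_natl.
  by apply: ler_wpMn2l => //; rewrite mulr_ge0.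
have bvalD (x x' : VN) l l' : bounded_by x l -> bounded_by x' l' ->
    bounded_by (vn_op (x + x')) (l + l').
  by move=> xl xl'; apply: bounded_byD.
apply: (bvalD); last by apply: block => //; exact: ltnW.
apply: (bvalD); first by rewrite eE'; exact: eb k k0 yk.
rewrite big_seq [vn_op _](raddf_sum (\val : VN -> bop H)).
rewrite [X in bounded_by _ X]big_seq; apply: bounded_by_sum => p.
rewrite mem_index_iota => /andP[p1 pq].
have p4 : (p < 4)%N by rewrite (ltn_trans pq).
have := block n (inord p) (4 ^ n.+1)%N y k _ (leqnn _) k0 yk; rewrite inordK//.
by apply; rewrite -val_eqE /= inordK// -lt0n.
Qed.

End haar_partial_sums.

(** The functional is represented on the vectors of each level by some [xi n].  The
    square norms of these are bounded and increase, and the square distance of two of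
    them is the difference of their square norms; hence they converge. *)
Lemma riesz (T : bop H) v : exists xi, forall u, dot (T u) v = dot u xi.
Proof.
have /choice[xi xiP] n : exists xi : H, (exists b : 'M[C]_(2 ^ n.+1), xi = gns_vec b) /\
    forall a : 'M[C]_(2 ^ n.+1), dot (T (gns_vec a)) v = dot (gns_vec a) xi.
  have L_lin : scalar (fun a : 'M[C]_(2 ^ n.+1) => dot (T (gns_vec a)) v).
    by move=> c a b; rewrite gns_vec_linear bop_lin dotDl dotZl.
  have [c cP] := level_state_riesz alpha_gt0 alpha_lt1 L_lin.
  exists (gns_vec (c ^t*)); split=> [|a]; first by exists (c ^t*).
  by rewrite cP dot_gns_vec adjmxK.
have xi_dot n m : (n <= m)%N -> dot (xi n) (xi m) = `|xi n| ^+ 2.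
  move=> nm; have [[b bE] _] := xiP n; have [b' [b'E _ _ _]] := lift_level b nm.
  have bb' : gns_vec b = gns_vec b' by rewrite /gns_vec b'E.
  by rewrite -dot_norm {1 2}bE -[in RHS](proj2 (xiP n)) bb' (proj2 (xiP m)).
have [c c0 Tc] := bop_bound T.
have xi_le n : `|xi n| <= c * `|v|.
  have [->|x0] := eqVneq (xi n) 0; first by rewrite normr0 mulr_ge0// ltW.
  have nx : 0 < `|xi n| by rewrite normr_gt0.
  rewrite -(ler_pM2r nx) -expr2 -dot_norm; have [[b bE] bP] := xiP n.
  rewrite -[leLHS]ger0_norm ?dot_norm ?exprn_ge0// -dot_norm {1}bE -bP -bE.
  rewrite (le_trans (cauchy_schwarz _ _))// mulrAC ler_wpM2r//.
pose t n : R := complex.Re (`|xi n| ^+ 2).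
have tE n : (t n)%:C%C = `|xi n| ^+ 2.
  by rewrite /t RRe_real.
have xi_dist n m : (n <= m)%N -> `|xi m - xi n| ^+ 2 = (t m - t n)%:C%C.
  move=> nm; rewrite -dot_norm dotBl !dotBr (dotC (xi m) (xi n)) (xi_dot n m)//.
  rewrite !dot_norm rmorphB/= !tE conj_Creal ?ger0_real ?exprn_ge0//.
  by rewrite subrr subr0.
have t_mono n m : (n <= m)%N -> t n <= t m.
  by move=> nm; rewrite -subr_ge0 -ler0c -xi_dist// exprn_ge0.
have t_sup : has_sup (range t).
  split; first by exists (t 0), 0%N.
  have /complex_realP[B BE] : (c * `|v|) ^+ 2 \is Num.real.
    by rewrite ger0_real// exprn_ge0// mulr_ge0// ltW.
  exists B => _ [n _ <-]; rewrite -lecR tE -BE ler_pXn2r// nnegrE// mulr_ge0//.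
  exact: ltW.
(* the distance of [xi n] to all later ones, and so to the limit *)
pose b n : C := (Num.sqrt (sup (range t) - t n))%:C%C.
have t_le n : t n <= sup (range t) by apply: sup_upper_bound => //; exists n.
have b_mono n m : (n <= m)%N -> b m <= b n.
  by move=> nm; rewrite lecR ler_wsqrtr// lerB// t_mono.
have b_small (e : C) : 0 < e -> exists n, b n < e.
  move=> /gt0_complexP[r r0 ->].
  have [_ [n _ <-] nr] := sup_adherent (exprn_gt0 2 r0) t_sup.
  exists n; rewrite ltcR -(ger0_norm (ltW r0)) -sqrtr_sqr ltr_sqrt ?exprn_gt0//.
  by rewrite ltrBlDr addrC -ltrBlDr.
have [l lP] : exists l, forall n, `|l - xi n| <= b n.
  apply: cauchy_modulus_lim => // n m nm.
  rewrite -(@ler_pXn2r _ 2) ?nnegrE ?ler0c ?sqrtr_ge0// xi_dist// /b.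
  by rewrite -rmorphXn/= lecR sqr_sqrtr ?subr_ge0// lerD2r.
exists l; apply: (dot_dense (gns_vec_approx 0)) => _ [n [a [_ ->]]].
apply/eqP; rewrite -subr_eq0; apply/eqP.
apply: (@small_norm_eq0 _ C^o `|gns_vec a|) => e e0.
have [n' be] := b_small e e0; pose m := maxn n n'.
have [a' [a'E _ _ _]] := lift_level a (leq_maxl n n').
have aa' : gns_vec a = gns_vec a' by rewrite /gns_vec a'E.
rewrite {1 2}aa' (proj2 (xiP m)) -dotBr (le_trans (cauchy_schwarz _ _))// -aa'.
rewrite ler_wpM2l// distrC (le_trans (lP m))// (le_trans _ (ltW be))//.
by rewrite b_mono// leq_maxr.
Qed.

(** In the left case this is the vector functional of [x Omega] and [Omega]; in the
    right case the adjoint of [x] applied to [Omega] is supplied by [riesz]. *)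
Lemma predual_embed_normal s (x : VN) :
  normal_functional (fun y : VN => phi (side_vn_mul s y x) : C^o).
Proof.
case: s; first exact: vector_functional_normal (x Omega) Omega.
have [xi xiP] := riesz x Omega.
rewrite (_ : (fun y => _) = vector_functional Omega xi).
  exact: vector_functional_normal.
by apply/funext => y; rewrite /vector_functional -xiP.
Qed.

Lemma predual_embed_in s (x : VN) :
  (fun y : VN => phi (side_vn_mul s y x) : C^o) \in
    @normal_functional_pred R H (range pi).
Proof. exact/asboolP/predual_embed_normal. Qed.

Definition predual_embed s (x : VN) : predual (range pi) :=
  Predual (predual_embed_in s x).

Lemma predual_embed_linear s : linear (predual_embed s).
Proof.
move=> c x y; apply/val_inj/funext => z /=.
by rewrite side_vn_mul_linearr vector_state_scalar.
Qed.

(** Tested on matrices, the vanishing of the functional of [x] on one side is the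
    hypothesis of [vn_separating] on the other side. *)
Lemma predual_embed_inj s : injective (predual_embed s).
Proof.
move=> x x' e; apply/eqP; rewrite -subr_eq0; apply/eqP.
apply: (@vn_separating (~~ s)) => n c.
have -> : side_vn_mul (~~ s) (x - x') (vn_mx c) = side_vn_mul s (vn_mx c) (x - x').
  by rewrite /side_vn_mul; case: s {e}.
have : predual_embed s (x - x') (vn_mx c) = 0.
  by rewrite (linB (predual_embed_linear s)) e subrr.
by [].
Qed.

Section approximation.
Variable s : bool.

(** Membership in the norm closure of the embedded matrix algebras, stated for plain
    functions so that it can be proved before normality is known. *)
Definition approximable (psi : VN -> C) : Prop := forall e : C, 0 < e ->
  exists n (x : 'M[C]_(2 ^ n.+1)), forall y : VN, contractive y ->
    `|psi y - phi (side_vn_mul s y (vn_mx x))| <= e.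

(** Vectors [a Omega] and [b Omega] approximate [xi] and [eta], and their functional
    is an embedded matrix by [kms_transfer]. *)
Lemma approximable_vector xi eta : approximable (fun y => dot (y xi) eta).
Proof.
move=> e e0; have e2 : 0 < e / 2 by rewrite divr_gt0.
have n1 : 0 < `|eta| + 1 by rewrite ltr_wpDl.
have [_ [n [a [_ ->]]] xa] := gns_vec_approx 0 xi (divr_gt0 e2 n1).
have n2 : 0 < `|gns_vec a| + 1 by rewrite ltr_wpDl.
have [_ [m [b [nm ->]]] eb] := gns_vec_approx n eta (divr_gt0 e2 n2).
have [a' [a'E _ _ _]] := lift_level a nm.
have aa' : gns_vec a = gns_vec a' by rewrite /gns_vec a'E.
have [c cP] := kms_transfer s a' b.
exists m, c => y y1; rewrite -cP -aa'.
have -> : dot (y xi) eta - dot (y (gns_vec a)) (gns_vec b) =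
    dot (y (xi - gns_vec a)) eta + dot (y (gns_vec a)) (eta - gns_vec b).
  by rewrite (linB (bop_lin y)) dotBl dotBr addrA subrK.
rewrite (le_trans (ler_normD _ _))// (splitr e) lerD//.
  rewrite (le_trans (cauchy_schwarz _ _))//.
  rewrite ltr_pdivlMr// in xa; rewrite (le_trans _ (ltW xa))//.
  by rewrite ler_pM// lerDl.
rewrite (le_trans (cauchy_schwarz _ _))//.
rewrite ltr_pdivlMr// in eb; rewrite (le_trans _ (ltW eb))// [leRHS]mulrC.
by rewrite ler_pM// (le_trans (y1 _))// lerDl.
Qed.

Lemma approximable0 : approximable (fun=> 0).
Proof.
move=> e e0; exists 0%N, 0 => y _.
rewrite (lin0 (s := GRing.scale) (@vn_mx_linear 0)).
rewrite (lin0 (s := GRing.scale) (side_vn_mul_linearr s y)).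
by rewrite (lin0 vector_state_scalar) subr0 normr0 ltW.
Qed.

Lemma approximable_lin (c : C) psi psi' : approximable psi -> approximable psi' ->
  approximable (fun y => c * psi y + psi' y).
Proof.
move=> ap ap' e e0; have c1 : 0 < `|c| + 1 by rewrite ltr_wpDl.
have [n [x xP]] := ap _ (divr_gt0 e0 (mulr_gt0 (ltr0n C 2) c1)).
have [n' [x' xP']] := ap' _ (divr_gt0 e0 (ltr0n C 2)).
have [z [zE _ _ _]] := lift_level x (leq_maxl n n').
have [z' [zE' _ _ _]] := lift_level x' (leq_maxr n n').
have vE : vn_mx z = vn_mx x by apply/val_inj.
have vE' : vn_mx z' = vn_mx x' by apply/val_inj.
exists (maxn n n'), (c *: z + z') => y y1.
rewrite vn_mx_linear side_vn_mul_linearr vector_state_scalar vE vE' opprD addrACA -mulrBr.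
rewrite (le_trans (ler_normD _ _))// (splitr e) lerD//; last exact: xP'.
rewrite normrM (le_trans (ler_wpM2l _ (xP y y1)))//.
have -> : `|c| * (e / (2 * (`|c| + 1))) = (e / 2) * (`|c| / (`|c| + 1)).
  by field; rewrite gt_eqF.
by rewrite ler_piMr ?divr_ge0 ?(ltW e0)// ler_pdivrMr// mul1r lerDl.
Qed.

Lemma approximable_unif psi : (forall e : C, 0 < e -> exists2 psi', approximable psi' &
    forall y : VN, contractive y -> `|psi y - psi' y| <= e) -> approximable psi.
Proof.
move=> ap e e0; have e2 : 0 < e / 2 by rewrite divr_gt0.
have [psi' ap' psiE] := ap _ e2; have [n [x xP]] := ap' _ e2.
exists n, x => y y1; rewrite -(subrKA (psi' y)) (le_trans (ler_normD _ _))//.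
by rewrite (splitr e) lerD ?psiE ?xP.
Qed.

Lemma approximable_pairing p : square_summable p.1 -> square_summable p.2 ->
  approximable (fun y => ultraweak_pairing p y).
Proof.
move=> sq1 sq2; apply: approximable_unif => e e0.
have [N NP] := pairing_approx sq1 sq2 e0.
exists (fun y : VN => \sum_(0 <= k < N) dot (y (p.1 k)) (p.2 k)).
  elim: N {NP} => [|N IH].
    rewrite (_ : (fun _ => _) = fun=> 0); first exact: approximable0.
    by apply/funext => y; rewrite big_nil.
  rewrite (_ : (fun _ => _) = fun y : VN => 1 * dot (y (p.1 N)) (p.2 N) +
      \sum_(0 <= k < N) dot (y (p.1 k)) (p.2 k)).
    by apply: approximable_lin => //; exact: approximable_vector.
  by apply/funext => y; rewrite big_nat_recr//= mul1r addrC.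
by move=> y /contractiveP y1; have := NP y 1 ler01 y1; rewrite mul1r.
Qed.

(** Ultraweak continuity at 0 makes [psi] vanish on the common kernel of finitely many
    ultraweak pairings, so [psi] is a linear combination of them. *)
Lemma approximable_normal (psi : VN -> C^o) : normal_functional psi -> approximable psi.
Proof.
move=> [psi_lin _ psi_uw].
have [F F_sq [d d0 Fd]] := psi_uw 0 1 ltr01.
have psi0 : psi 0 = 0 := lin0 (s := GRing.scale) psi_lin.
apply: (@kernel_induction C VN _ (fun p y => ultraweak_pairing p (vn_op y))
  approximable approximable0 approximable_lin F psi) => //.
- move=> p /F_sq[sq1 sq2] c x y; rewrite -(pairing_linear sq1 sq2 c x y).
  by [].
- by move=> p /F_sq[sq1 sq2]; exact: (approximable_pairing sq1 sq2).
move=> y yF; apply/eqP/negPn/negP => psiy.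
have npsi : 0 < `|psi y : C| by rewrite normr_gt0.
pose c : C := (`|psi y : C|)^-1.
suff : `|psi (c *: y) - psi 0 : C| < 1.
  have -> : psi (c *: y) = c * psi y :> C.
    exact: (linZ (s := GRing.scale) psi_lin).
  rewrite psi0 subr0.
  by rewrite normrM /c gtr0_norm ?invr_gt0// mulVf ?ltxx// gt_eqF.
apply: Fd => p pF; have [sq1 sq2] := F_sq p pF.
rewrite (_ : _ - _ = c *: vn_op y + (0 : bop H)); last by rewrite subr0 addr0.
rewrite (pairing_linear sq1 sq2) yF// mulr0 add0r.
have := pairing_linear sq1 sq2 0 0 0; rewrite scale0r addr0 mul0r add0r => _.
have -> : ultraweak_pairing p (0 : bop H) = 0.
  have := pairing_linear sq1 sq2 (-1) 0 0.
  by rewrite scaler0 addr0 mulN1r addNr.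
by rewrite normr0.
Qed.

End approximation.

Section haar_basis.
Variables (s : bool) (r : 'I_4 -> 'M[C]_2).
Hypothesis r0 : r ord0 = 1%:M.
Hypothesis r_orth : forall p q, @side_form R alpha s 0 (r p) (r q) = (p == q)%:R.

Local Notation haar_sqnorm := (haar_sqnorm alpha s r).

(** The coefficient functionals evaluate at the adjoints of the Haar elements;
    partial sums are then transposes of [haar_partial_sum]. *)
Theorem haar_schauder_basis :
  schauder_basis (fun j => predual_embed s (haar_seq pi f r j)).
Proof.
pose a j (psi : predual (range pi)) : C :=
  (haar_sqnorm j j)^-1 * psi (vn_mx ((haar r j j) ^t*)).
have jj j : (j < 4 ^ j.+1)%N by rewrite (ltn_trans (ltnSn j))// ltn_expl.
have nu0 j : haar_sqnorm j j != 0.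
  by rewrite gt_eqF// (haar_sqnorm_gt0 alpha_gt0 alpha_lt1 r_orth).
have sumE m (psi : predual (range pi)) (y : VN) :
    (\sum_(0 <= j < m) a j psi *: predual_embed s (haar_seq pi f r j)) y =
    psi (haar_partial_sum s r m y) :> C.
  have psi_lin := predual_scalar psi.
  rewrite /haar_partial_sum (lin_sum psi_lin).
  rewrite (big_morph (fun psi' : predual (range pi) => psi' y : C)
    (id1 := 0) (op1 := +%R))//.
  apply: eq_bigr => j _; rewrite (linZ psi_lin)/= -[LHS]/(a j psi * _).
  by rewrite /a mulrAC.
have [c c0 cP] := haar_partial_sum_bounded r0 r_orth.
apply: (@schauder_criterion _ _ _ a c).
- by move=> j d psi psi'; rewrite /a -[X in _ * X]/(d * psi _ + psi' _) mulrDr mulrCA.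
- move=> j; have [k k0 kb] := bop_bound (vn_mx ((haar r j j) ^t*)).
  exists (`|(haar_sqnorm j j)^-1| * k) => psi; rewrite /a normrM -mulrA ler_wpM2l//.
  by rewrite predual_norm_bound ?(ltW k0).
- move=> j k; rewrite /a /=.
  pose n := maxn j k.
  have jn : (j < 4 ^ n.+1)%N by rewrite (leq_trans (jj j))// leq_exp2l// ltnS leq_maxl.
  have kn : (k < 4 ^ n.+1)%N by rewrite (leq_trans (jj k))// leq_exp2l// ltnS leq_maxr.
  have [_ nuE hE _] := haar_term_level r0 r_orth 0 jn.
  have [hkE _ _ _] := haar_term_level r0 r_orth 0 kn.
  rewrite nuE hE hkE.
  have [nu_pos orth] := haar_orthogonal alpha_gt0 alpha_lt1 r_orth jn kn.
  have -> : phi (side_vn_mul s (vn_mx ((haar r n j) ^t*)) (vn_mx (haar r n k))) =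
      side_form alpha s (haar r n j) (haar r n k).
    rewrite /side_form -dot_mxop /side_mulmx /side_vn_mul; case: (s); rewrite /vector_state /=.
      by rewrite mxopM.
    by rewrite mxopM.
  rewrite orth; case: eqP => _; last by rewrite mulr0n mulr0.
  by rewrite mulr1n mulVf// gt_eqF.
- move=> m psi; apply: predual_norm_le => y /contractiveP y1.
  rewrite sumE; have := cP m y 1 ler01 y1; rewrite mulr1 => yc.
  exact: predual_norm_bound.
move=> psi d d0.
have d2 : 0 < d / 2 by rewrite divr_gt0.
have [n [x xP]] := approximable_normal s (predualP psi) d2.
(* [haar_complete] expands in the adjoint system, so it is applied to [x ^t*] *)
pose b j : C := ((haar_sqnorm n j)^-1 * tau (side_mulmx s (x ^t*) (haar r n j)))^*.
exists (4 ^ n.+1)%N, b.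
have -> : \sum_(0 <= j < 4 ^ n.+1) b j *: predual_embed s (haar_seq pi f r j) =
    predual_embed s (vn_mx x).
  rewrite -[in RHS](adjmxK x).
  rewrite -[in RHS](haar_complete alpha_gt0 alpha_lt1 r_orth (x ^t*)).
  rewrite linear_sum/= rmorph_sum/=.
  rewrite (lin_sum (s := GRing.scale) (@vn_mx_linear _)).
  rewrite (lin_sum (s := GRing.scale) (@predual_embed_linear s)).
  apply: eq_big_nat => j /andP[_ jn].
  have [-> _ _ _] := haar_term_level r0 r_orth 0 jn.
  rewrite -(linZ (s := GRing.scale) (@predual_embed_linear s)).
  rewrite -(linZ (s := GRing.scale) (@vn_mx_linear _)).
  congr (predual_embed s (vn_mx _)); apply/matrixP => k l; rewrite !mxE rmorphM/=.
  by rewrite conjCK.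
rewrite (@le_lt_trans _ _ (d / 2))//; last first.
  by rewrite ltr_pdivrMr// ltr_pMr// ltr1n.
by apply: predual_norm_le => y y1; exact: xP.
Qed.

End haar_basis.

End gns_space.

(** * The two systems of the theorem *)

Section concrete_systems.
Local Open Scope sesquilinear_scope.
Context {R : realType}.
Local Notation C := R[i].
Variable alpha : R.
Hypotheses (alpha_gt0 : 0 < alpha) (alpha_lt1 : alpha < 1).
Let lambda := alpha / (1 - alpha).

Lemma level_state_mx2 (a b c d a' b' c' d' : C) :
  @level_state R alpha 0 ((mx2 a b c d) ^t* *m mx2 a' b' c' d') =
  (a^* * a' + c^* * c') * alpha%:C%C + (b^* * b' + d^* * d') * (1 - alpha)%:C%C.
Proof.
rewrite level_stateE !big_ord_recl big_ord0 addr0 /weight /=.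
by rewrite !mxE /= !big_ord_recl !big_ord0 !mxE /= !addr0.
Qed.

Lemma mx2_scalar1 : 1%:M = mx2 1 0 0 1 :> 'M[C]_2.
Proof.
by apply/matrixP => i j; rewrite !mxE; move: i j => [[|[]]//= ?] [[|[]]//= ?].
Qed.

(** With [t ^ 2 = lambda] the weights are [t ^ 2 / (1 + t ^ 2)] and [1 / (1 + t ^ 2)],
    and the sixteen identities are rational in [t]. *)
Lemma left_system_r_left : left_system alpha (r_left lambda).
Proof.
have l0 : 0 < lambda by rewrite divr_gt0// subr_gt0.
pose t : C := (Num.sqrt lambda)%:C%C.
have t0 : t != 0 by rewrite gt_eqF// ltcR sqrtr_gt0.
have tt : t ^+ 2 = (lambda)%:C%C by rewrite -rmorphXn/= sqr_sqrtr// ltW.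
have tJ : t^* = t by rewrite conj_Creal//; apply/complex_realP; exists (Num.sqrt lambda).
have tVJ : (t^-1)^* = t^-1 by rewrite fmorphV/= tJ.
have t1 : 1 + t ^+ 2 != 0 by rewrite tt gt_eqF// ltr_wpDr// ler0c ltW.
have aE : alpha%:C%C = t ^+ 2 / (1 + t ^+ 2) :> C.
  rewrite tt -(rmorph1 (real_complex R)) -rmorphD -fmorphV
    -rmorphM /lambda; congr (_%:C%C).
  have a1 : 1 - alpha != 0 by rewrite subr_eq0 gt_eqF.
  have -> : 1 + alpha / (1 - alpha) = (1 - alpha)^-1.
    by rewrite -[RHS]mul1r -{3}(subrK alpha 1) mulrDl mulfV.
  by rewrite invrK divfK.
have bE : (1 - alpha)%:C%C = 1 / (1 + t ^+ 2) :> C.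
  by rewrite rmorphB/= aE; field.
have entries j : r_left lambda j = nth 0 [:: mx2 1 0 0 1; mx2 t^-1 0 0 (- t);
    mx2 0 1 1 0; mx2 0 (- t) t^-1 0] j.
  by rewrite /r_left (tnth_nth 0) /= -/t mx2_scalar1.
move=> j k; rewrite !entries.
move: j k => [[|[|[|[|//]]]] hj] [[|[|[|[|//]]]] hk];
  rewrite -val_eqE /= level_state_mx2 aE bE ?rmorph0 ?rmorph1 ?rmorphN /= ?tJ ?tVJ;
  field; by rewrite ?t0 ?t1.
Qed.

Lemma r_right_adj j : r_right lambda j = (r_left lambda j) ^t*.
Proof.
have rJ (x : R) : (x%:C%C : C)^* = x%:C%C.
  by rewrite conj_Creal//; apply/complex_realP; exists x.
rewrite /r_right /r_left !(tnth_nth 0).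
move: j => [[|[|[|[|//]]]] hj] //=; apply/matrixP => p q; rewrite !mxE.
- by rewrite eq_sym rmorph_nat.
- by move: p q => [[|[]]//= ?] [[|[]]//= ?];
    rewrite ?rmorph0 ?rmorphN ?fmorphV /= ?rJ.
- by move: p q => [[|[]]//= ?] [[|[]]//= ?]; rewrite ?rmorph0 ?rmorph1.
Qed.

Lemma right_system_r_right : right_system alpha (r_right lambda).
Proof.
by move=> j k; rewrite !r_right_adj adjmxK left_system_r_left.
Qed.

End concrete_systems.

Theorem corollary13 (R : realType) (alpha : R)
  (A : cstarType R) (f : forall n, 'M[R[i]]_(2 ^ n.+1) -> A) (rho : A -> R[i])
  (H : hilbertType R) (pi : A -> bop H) (Omega : H)
  (alpha_gt0 : 0 < alpha) (alpha_lt : alpha < 1 / 2)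
  (limA : inductive_limit f)
  (state_rho : state rho)
  (rho_level : forall n x, rho (f n x) = level_state alpha x)
  (gns_pi : gns rho pi Omega) :
  let lambda := alpha / (1 - alpha) in
  let Ralpha := vnalg (range pi) in
  let rho_alpha : Ralpha -> R[i] := vector_state Omega in
  (left_system alpha (r_left lambda) /\
   exists emb : Ralpha -> predual (range pi),
     [/\ linear emb, injective emb,
         forall x y, emb x y = rho_alpha (vn_mul y x) &
         schauder_basis (fun j => emb (haar_seq pi f (r_left lambda) j))]) /\
  (right_system alpha (r_right lambda) /\
   exists emb : Ralpha -> predual (range pi),
     [/\ linear emb, injective emb,
         forall x y, emb x y = rho_alpha (vn_mul x y) &
         schauder_basis (fun j => emb (haar_seq pi f (r_right lambda) j))]).
Proof.
move=> lambda Ralpha rho_alpha.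
have alpha_lt1 : alpha < 1.
  by rewrite (lt_trans alpha_lt)// ltr_pdivrMr// mul1r ltr1n.
pose emb s := predual_embed alpha_gt0 alpha_lt1 limA rho_level gns_pi s.
have basis s r (r0 : r ord0 = 1%:M) (r_orth : forall p q,
    @side_form R alpha s 0 (r p) (r q) = (p == q)%:R) :
    [/\ linear (emb s), injective (emb s) &
      schauder_basis (fun j => emb s (haar_seq pi f r j))].
  split; first exact: predual_embed_linear.
    exact: predual_embed_inj.
  exact: (haar_schauder_basis alpha_gt0 alpha_lt1 limA rho_level state_rho gns_pi
    r0 r_orth).
have left_r := left_system_r_left alpha_gt0 alpha_lt1.
have right_r := right_system_r_right alpha_gt0 alpha_lt1.
split; split=> //.
  have [] := basis true (r_left lambda) (erefl _) left_r.
  by move=> lin inj sch; exists (emb true).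
have [|lin inj sch] := basis false (r_right lambda) (erefl _).
  by move=> p q; rewrite eq_sym; exact: right_r.
by exists (emb false).
Qed.
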